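(* Let $G$ and $H$ be finite groups. If $G$ is metacyclic and the subrack lattices $\mathcal{R}(G)$ and $\mathcal{R}(H)$ are isomorphic as lattices, then $H/Z(H)$ is metacyclic, where $Z(H)$ denotes the center of $H$.
   Context: A rack is a set $X$ with a binary operation $\triangleright\colon X\times X\to X$ such that (A1) $a\triangleright(b\triangleright c)=(a\triangleright b)\triangleright(a\triangleright c)$ for all $a,b,c\in X$, and (A2) for all $a,c\in X$ there is a unique $b\in X$ with $a\triangleright b=c$. A subrack of $X$ is a subset (possibly empty) that is itself a rack under the restricted operation. A group $G$ is regarded as a rack (the group rack) via conjugation $a\triangleright b:=aba^{-1}$. $\mathcal{R}(X)$ denotes the set of all subracks of $X$ ordered by inclusion; it is a lattice, called the subrack lattice of $X$. A group $G$ is called metacyclic if it has a cyclic normal subgroup $N$ such that $G/N$ is also cyclic. *)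

(* Defs.v *)
Set Warnings "-notation-overridden,-projection-no-head-constant,-redundant-canonical-projection".
From HB Require Import structures.
From mathcomp Require Import all_boot all_order all_fingroup all_solvable.

Set Implicit Arguments.
Unset Strict Implicit.
Unset Printing Implicit Defensive.

Import Order.Theory.
Local Open Scope group_scope.

(* The third clause states unique solvability of op a b = c within A. *)
Definition is_rack (T : finType) (op : T -> T -> T) (A : {set T}) : bool :=
  [&& [forall a in A, forall b in A, op a b \in A],
      [forall a in A, forall b in A, forall c in A,
         op a (op b c) == op (op a b) (op a c)]
    & [forall a in A, forall c in A, #|[set b in A | op a b == c]| == 1%N]].

Lemma is_rackP (T : finType) (op : T -> T -> T) (A : {set T}) :
  reflect [/\ {in A &, forall a b, op a b \in A},
              {in A & &, forall a b c, op a (op b c) = op (op a b) (op a c)}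
            & {in A &, forall a c, exists! b, b \in A /\ op a b = c}]
          (is_rack op A).
Proof.
apply: (iffP and3P) => [] [clA dA uA]; split.
- by move=> a b aA bA; move/forall_inP/(_ a aA)/forall_inP/(_ b bA): clA.
- move=> a b c aA bA cA; apply/eqP.
  by move/forall_inP/(_ a aA)/forall_inP/(_ b bA)/forall_inP/(_ c cA): dA.
- move=> a c aA cA.
  move/forall_inP/(_ a aA)/forall_inP/(_ c cA)/cards1P: uA => [b defb].
  have inb x : (x \in A) && (op a x == c) = (x == b).
    by move/setP/(_ x): defb; rewrite !inE.
  exists b; split=> [|x [xA opx]].
    by have := inb b; rewrite eqxx => /andP[bA /eqP].
  by apply/esym/eqP; rewrite -inb xA opx eqxx.
- by apply/forall_inP=> a aA; apply/forall_inP=> b bA; apply: clA.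
- apply/forall_inP=> a aA; apply/forall_inP=> b bA; apply/forall_inP=> c cA.
  by apply/eqP/dA.
- apply/forall_inP=> a aA; apply/forall_inP=> c cA; apply/cards1P.
  have [b [[bA opb] ub]] := uA a c aA cA; exists b; apply/setP=> x.
  rewrite !inE; apply/andP/eqP => [[xA /eqP opx] | ->]; last by rewrite opb.
  by rewrite -(ub x).
Qed.

Record rack (T : finType) := Rack {
  rack_op : T -> T -> T;
  rack_set :> {set T};
  rackP : is_rack rack_op rack_set
}.

Section SubrackLattice.

Variables (T : finType) (X : rack T).

Definition is_subrack (A : {set T}) : bool :=
  (A \subset X) && is_rack (rack_op X) A.

Record subrack := Subrack {
  subrack_set :> {set T};
  subrackP : is_subrack subrack_set
}.

HB.instance Definition _ := [isSub for subrack_set].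
HB.instance Definition _ := [Finite of subrack by <:].

Lemma rack_is_subrack : is_subrack X.
Proof. by rewrite /is_subrack subxx rackP. Qed.

Lemma is_subrackI (A B : {set T}) :
  is_subrack A -> is_subrack B -> is_subrack (A :&: B).
Proof.
case/andP=> sAX /is_rackP[clA dA uA]; case/andP=> sBX /is_rackP[clB _ uB].
have /is_rackP[_ _ uX] := rackP X.
have [inAX inBX] := (subsetP sAX, subsetP sBX).
apply/andP; split; first by rewrite subIset ?sAX.
apply/is_rackP; split.
- by move=> a b /setIP[aA aB] /setIP[bA bB]; rewrite inE clA ?clB.
- by move=> a b c /setIP[aA _] /setIP[bA _] /setIP[cA _]; apply: dA.
move=> a c /setIP[aA aB] /setIP[cA cB].
have [b [[bA opb] ub]] := uA a c aA cA.
have [b' [[b'B opb'] _]] := uB a c aB cB.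
have [x [_ ux]] := uX a c (inAX a aA) (inAX c cA).
have defb : b = b'.
  by rewrite -(ux b (conj (inAX b bA) opb)) -(ux b' (conj (inBX b' b'B) opb')).
exists b; split=> [|y [/setIP[yA _] opy]]; last exact: ub.
by split=> //; rewrite inE bA defb.
Qed.

(* Junk value setT when S is not a subset of X. *)
Definition subrack_gen (S : {set T}) : {set T} :=
  \bigcap_(A : {set T} | is_subrack A && (S \subset A)) A.

Lemma subrack_gen_subrack (S : {set T}) :
  S \subset X -> is_subrack (subrack_gen S).
Proof.
move=> sSX; have -> : subrack_gen S = X :&: subrack_gen S.
  by apply/esym/setIidPr/bigcap_inf; rewrite rack_is_subrack.
apply: (big_ind (fun A => is_subrack (X :&: A))).
- by rewrite setIT rack_is_subrack.
- by move=> A B sA sB; rewrite setIIr is_subrackI.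
- by move=> A /andP[sA _]; rewrite is_subrackI ?rack_is_subrack.
Qed.

Lemma subrack_gen_sub (S A : {set T}) :
  is_subrack A -> (subrack_gen S \subset A) = (S \subset A).
Proof.
move=> rA; apply/idP/idP => [|sSA]; last by apply: bigcap_inf; rewrite rA.
by apply: subset_trans; apply/bigcapsP=> B /andP[].
Qed.

Definition subrack_le (A B : subrack) : bool := A \subset B.

Lemma subrack_le_refl : reflexive subrack_le.
Proof. by move=> A; apply: subxx. Qed.

Lemma subrack_le_anti : antisymmetric subrack_le.
Proof. by move=> A B sAB; apply/val_inj/eqP; rewrite eqEsubset. Qed.

Lemma subrack_le_trans : transitive subrack_le.
Proof. by move=> B A C; apply: subset_trans. Qed.

Fact subrack_display : Order.disp_t. Proof. exact: Order.Disp tt tt. Qed.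

HB.instance Definition _ := Order.Le_isPOrder.Build subrack_display subrack
  subrack_le_refl subrack_le_anti subrack_le_trans.

Definition subrack_meet (A B : subrack) : subrack :=
  Subrack (is_subrackI (subrackP A) (subrackP B)).

Lemma subrack_joinS (A B : subrack) : A :|: B \subset X.
Proof.
by rewrite subUset; case/andP: (subrackP A) => ->; case/andP: (subrackP B).
Qed.

Definition subrack_join (A B : subrack) : subrack :=
  Subrack (subrack_gen_subrack (subrack_joinS A B)).

Lemma subrack_meetP (A B C : subrack) :
  (A <= subrack_meet B C)%O = (A <= B)%O && (A <= C)%O.
Proof. exact: subsetI. Qed.

Lemma subrack_joinP (A B C : subrack) :
  (subrack_join A B <= C)%O = (A <= C)%O && (B <= C)%O.
Proof.
by rewrite -[LHS]/(_ \subset _) subrack_gen_sub ?subrackP // subUset.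
Qed.

HB.instance Definition _ :=
  Order.POrder_MeetJoin_isLattice.Build subrack_display subrack
    subrack_meetP subrack_joinP.

End SubrackLattice.

Section GroupRack.

Variables (gT : finGroupType) (G : {group gT}).

(* This is b ^ a^-1, not the library's b ^ a = a^-1 * b * a. *)
Definition conj_op (a b : gT) : gT := a * b * a^-1.

Lemma conj_op_is_rack : is_rack conj_op G.
Proof.
apply/is_rackP; split.
- by move=> a b aG bG; rewrite !groupM ?groupV.
- by move=> a b c _ _ _; rewrite /conj_op !invMg !invgK !mulgA !mulgKV.
move=> a c aG cG; exists (a^-1 * c * a); split=> [|b [_ <-]].
  by rewrite !groupM ?groupV // /conj_op !mulgA mulgV mul1g mulgK.
by rewrite /conj_op !mulgA mulVg mul1g mulgKV.
Qed.

Definition group_rack : rack gT := Rack conj_op_is_rack.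

End GroupRack.

Definition lattice_isomorphic d1 d2
    (L1 : latticeType d1) (L2 : latticeType d2) : Prop :=
  exists f : {lmorphism L1 -> L2}, bijective f.

(* Main.v *)
Require Import Defs.
From mathcomp Require Import all_boot all_order all_fingroup all_solvable.
From mathcomp Require Import zify.

(* A subrack of a group is a subset S contained in its own normaliser, and the atoms
   of the lattice are the singletons, so a lattice isomorphism is a bijection f of G
   onto H such that S and f(S) are subracks simultaneously.  Such an f preserves
   commutation, unions of conjugacy classes, and the subracks generated by pairs.

   Let G = <a><b> with <a> normal, A = C_G(a) = <a> Z(G) and B = f(A) = C_H(f(a)).
   Then B is abelian and normal in H, and H = B <f(b)>, so that it remains to show
   that V = B / Z(H) is cyclic.  For x in A, the size of the orbit of b under <b, x>
   is the order of the <b>-submodule generated by x in A / Z(G).  As f preserves it and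
   A / Z(G) is cyclic, for each m dividing |V| the module V has just one cyclic
   submodule of order m.

   If V is not cyclic it therefore has a uniserial submodule Y / Z(H) = C_p x C_p,
   which f matches with the subgroup X / Z(G) = C_(p^2) of A / Z(G).  Let c be the
   eigenvalue of f(b) on Y / Z(H).  If c <> 1 mod p, then d = f(b)^p is a scalar
   without nontrivial fixed points on Y / Z(H), so its orbit under <d, y> has at most p
   elements for y in Y, whereas the corresponding orbit in G can have p^2 elements.
   If c = 1 mod p, then some but not all of the elements of the orbit of f(b) under
   <f(b), y> other than f(b) commute with f(b), and the same holds for b.  It remains
   to compare the powers of b (of f(b)) whose centraliser in X (in Y) lies strictly
   between the centre and X (Y): for odd p there are some in G but none in H, and for
   p = 2 it is the other way round. *)

Set Implicit Arguments.
Unset Strict Implicit.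
Unset Printing Implicit Defensive.

Import Order.Theory GroupScope.

(** * From lattice isomorphisms to bijections *)

(** Solvability inside [S] of the equation for [a] and [c] puts [c ^ a] in [S]. Conversely, elements
    of ['N(S)] permute [S] under conjugation in both directions. *)
Lemma group_subrackE (gT : finGroupType) (G : {group gT}) (S : {set gT}) :
  is_subrack (group_rack G) S = (S \subset G) && (S \subset 'N(S)).
Proof.
rewrite /is_subrack; case: (boolP (S \subset G)) => //= sSG.
apply/is_rackP/subsetP => [[clS _ uS] x Sx | nSS].
  rewrite inE; apply/subsetP=> _ /imsetP[y Sy ->].
  have [b [[Sb <-] _]] := uS x y Sx Sy.
  by rewrite /= /conj_op conjgE !mulgA mulVg mul1g mulgKV.
have clS a b : a \in S -> b \in S -> b ^ a \in S by move=> /nSS/memJ_norm->.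
have clV a b : a \in S -> b \in S -> a * b * a^-1 \in S.
  move=> Sa Sb; have := memJ_norm b (groupVr (nSS a Sa)).
  by rewrite conjgE invgK mulgA Sb.
split=> //= [a b c _ _ _ | a c Sa Sc].
  by rewrite /conj_op !invMg !invgK !mulgA !mulgKV.
exists (c ^ a); split=> [|b [_ <-]].
  by rewrite clS // /conj_op conjgE !mulgA mulgV mul1g mulgK.
by rewrite /conj_op conjgE !mulgA mulVg mul1g mulgKV.
Qed.

(** The trace of a lattice isomorphism on elements: by [group_subrackE], the last clause says that
    [S] and [f @: S] are subracks simultaneously. *)
Definition subrack_bij (gT hT : finGroupType) (G : {set gT}) (H : {set hT})
    (f : gT -> hT) : Prop :=
  [/\ {in G &, injective f}, f @: G = H
    & forall S : {set gT}, S \subset G ->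
        (f @: S \subset 'N(f @: S)) = (S \subset 'N(S))].


Lemma mem_imset_in (aT rT : finType) (f : aT -> rT) (D A : {set aT}) x :
  {in D &, injective f} -> A \subset D -> x \in D ->
  (f x \in f @: A) = (x \in A).
Proof.
move=> injf /subsetP sAD Dx; apply/idP/idP => [/imsetP[y Ay] | ]; last first.
  exact: imset_f.
by move/injf => -> //; apply: sAD.
Qed.

Lemma imset_inj_in (aT rT : finType) (f : aT -> rT) (D A B : {set aT}) :
  {in D &, injective f} -> A \subset D -> B \subset D -> f @: A = f @: B -> A = B.
Proof.
move=> injf sAD sBD eqAB; apply/setP=> x.
have [Dx | D'x] := boolP (x \in D).
  by rewrite -(mem_imset_in injf sAD Dx) eqAB (mem_imset_in injf).
by rewrite (contraNF (subsetP sAD x) D'x) (contraNF (subsetP sBD x) D'x).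
Qed.

Lemma lattice_iso_subrack_bij (gT hT : finGroupType)
    (G : {group gT}) (H : {group hT}) :
  lattice_isomorphic (subrack (group_rack G)) (subrack (group_rack H)) ->
  exists f : gT -> hT, subrack_bij G H f.
Proof.
case=> F [F' FK F'K].
have FE (A B : subrack (group_rack G)) : (F A \subset F B) = (A \subset B).
  have leE (gT' : finGroupType) (G' : {group gT'})
      (C D : subrack (group_rack G')) : (C \subset D) = (C <= D)%O by [].
  by rewrite !leE !leEmeet -omorphI (can_eq FK).
have F'E (A : subrack (group_rack H)) (B : subrack (group_rack G)) :
  (F' A \subset B) = (A \subset F B) by rewrite -FE F'K.
have sub1 (gT' : finGroupType) (G' : {group gT'}) x : x \in G' ->
    is_subrack (group_rack G') [set x].
  move=> Gx; rewrite group_subrackE !sub1set Gx inE conjg_set1.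
  by rewrite conjgE mulKg subxx.
have sub0 (gT' : finGroupType) (G' : {group gT'}) :
    is_subrack (group_rack G') set0 by rewrite group_subrackE !sub0set.
pose s0 : subrack (group_rack G) := Subrack (sub0 _ G).
have Fs0 : F s0 = set0 :> {set hT}.
  apply/eqP; rewrite -subset0.
  suffices: F s0 \subset Subrack (sub0 _ H) by [].
  by rewrite -(F'K (Subrack (sub0 _ H))) FE sub0set.
have sFH A : F A \subset H.
  by have := subrackP (F A); rewrite group_subrackE => /andP[].
pose s x : subrack (group_rack G) := insubd s0 [set x].
have sE x : x \in G -> s x = [set x] :> {set gT}.
  by move=> Gx; rewrite /s insubdK //; apply: sub1.
(* The default [1] is taken only for [x] outside [G], where [s x] is empty. *)
pose f x := odflt 1 [pick y in (F (s x) : {set hT})].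
have fE x : x \in G -> F (s x) = [set f x] :> {set hT}.
  move=> Gx; rewrite /f; case: pickP => [y /= Fy | F0]; last first.
    have: s x \subset s0.
      by rewrite -FE; apply/subsetP=> y Fy; have:= F0 y; rewrite /= Fy.
    by rewrite sE // sub1set inE.
  have Hy : y \in H by apply: (subsetP (sFH (s x))).
  pose t := Subrack (sub1 _ H y Hy); have tE : t = [set y] :> {set hT} by [].
  have: F' t \subset s x by rewrite F'E tE sub1set.
  rewrite (sE x Gx) subset1 => /orP[/eqP eqt | /eqP t0].
    apply/eqP; rewrite eqEsubset sub1set Fy andbT.
    suffices: F (s x) \subset t by [].
    by rewrite -(F'K t) FE eqt (sE x Gx).
  have: t \subset F s0 by rewrite -F'E t0 sub0set.
  by rewrite Fs0 tE sub1set inE.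
have mem_f x A : x \in G -> (f x \in (F A : {set hT})) = (x \in (A : {set gT})).
  by move=> Gx; rewrite -!sub1set -fE // -sE // FE.
have f_inj : {in G &, injective f}.
  by move=> x y Gx Gy /eqP; rewrite -in_set1 -fE // mem_f // sE // inE => /eqP.
have pre_f y : y \in H -> exists2 x, x \in G & f x = y.
  move=> Hy.
  pose t := Subrack (sub1 _ H y Hy); have tE : t = [set y] :> {set hT} by [].
  have [F't0 | [x F'tx]] := set_0Vmem (F' t : {set gT}).
    have: t \subset F s0 by rewrite -F'E F't0 sub0set.
    by rewrite Fs0 tE sub1set inE.
  have Gx : x \in G.
    have := subrackP (F' t); rewrite group_subrackE => /andP[/subsetP].
    by move/(_ x F'tx).
  by exists x => //; apply/eqP; rewrite -in_set1 -tE -(F'K t) mem_f.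
have imE (A : subrack (group_rack G)) : F A = f @: A :> {set hT}.
  have := subrackP A; rewrite group_subrackE => /andP[/subsetP sAG _].
  apply/setP=> y; apply/idP/imsetP => [Fy | [x Ax ->]]; last by rewrite mem_f ?sAG.
  have [x Gx defy] := pre_f y (subsetP (sFH A) y Fy).
  by exists x; rewrite // -mem_f // defy.
have imG : f @: G = H.
  apply/setP=> y; apply/imsetP/idP => [[x Gx ->] | /pre_f[x Gx <-]]; last by exists x.
  by apply: (subsetP (sFH (s x))); rewrite fE ?set11.
exists f; split=> // S sSG; apply/idP/idP => nS.
  have rfS : is_subrack (group_rack H) (f @: S).
    by rewrite group_subrackE nS -imG imsetS.
  (* The subrack of [G] that [F] sends to [f @: S] has the same image as [S], so it is [S]. *)
  have := imE (F' (Subrack rfS)); rewrite F'K => /= eqfS.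
  have := subrackP (F' (Subrack rfS)); rewrite group_subrackE => /andP[sF'G].
  suffices -> : F' (Subrack rfS) = S :> {set gT} by [].
  by apply/esym/(imset_inj_in f_inj).
have rS : is_subrack (group_rack G) S by rewrite group_subrackE sSG.
have := subrackP (F (Subrack rS)).
by rewrite imE group_subrackE => /andP[].
Qed.

(** * Commuting pairs and subracks generated by two elements *)

Lemma set2_closedE (gT : finGroupType) (x y : gT) :
  ([set x; y] \subset 'N([set x; y])) = (y \in 'C[x]).
Proof.
have Jid (z : gT) : z ^ z = z by rewrite conjgE mulKg.
apply/idP/cent1P => [/subsetP nS | cxy].
  have := memJ_norm x (nS y (set22 x y)); rewrite set21 !inE => /orP[|] /eqP.
    by move/conjg_fixP/commgP.
  by rewrite -{2}(Jid y) => /conjg_inj ->.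
have [Jxy Jyx] : x ^ y = x /\ y ^ x = y.
  by split; apply/conjg_fixP/commgP.
apply/subsetP=> z zS; rewrite inE; apply/subsetP=> _ /imsetP[t tS ->].
by move: zS tS; rewrite !inE => /orP[] /eqP-> /orP[] /eqP->;
  rewrite ?Jid ?Jxy ?Jyx eqxx ?orbT.
Qed.

(** The subrack generated by [x] and [y]: a set that normalises itself and contains both is
    normalised by [<<[set x; y]>>], so it contains both classes. *)
Definition subrack2 (gT : finGroupType) (x y : gT) : {set gT} :=
  (x ^: <<[set x; y]>>) :|: (y ^: <<[set x; y]>>).

Section Subrack2.

Variables (gT : finGroupType) (x y : gT).

Lemma subrack2_closed : subrack2 x y \subset 'N(subrack2 x y).
Proof.
apply: (@subset_trans _ _ <<[set x; y]>>); last first.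
  by rewrite normsU ?class_norm.
rewrite subUset !class_subG ?mem_gen ?set21 ?set22 //.
Qed.

Lemma sub_subrack2 (S : {set gT}) :
  S \subset 'N(S) -> x \in S -> y \in S -> subrack2 x y \subset S.
Proof.
move=> nS Sx Sy.
have sKN : <<[set x; y]>> \subset 'N(S).
  by rewrite gen_subG; apply: subset_trans nS; rewrite subUset !sub1set Sx.
rewrite subUset !class_sub_norm //.
by rewrite Sx.
Qed.

End Subrack2.

(** * Invariants of subrack bijections *)

Section SubrackBij.

Variables (gT hT : finGroupType) (G : {group gT}) (H : {group hT}).
Variable f : gT -> hT.
Hypothesis fP : subrack_bij G H f.

Let f_inj : {in G &, injective f}. Proof. by case: fP. Qed.
Let f_im : f @: G = H. Proof. by case: fP. Qed.
Let f_closed (S : {set gT}) : S \subset G ->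
  (f @: S \subset 'N(f @: S)) = (S \subset 'N(S)).
Proof. by case: fP => _ _; apply. Qed.

Lemma subrack_bij_mem x : x \in G -> f x \in H.
Proof. by rewrite -f_im; apply: imset_f. Qed.

Lemma subrack_bij_surj y : y \in H -> exists2 x, x \in G & y = f x.
Proof. by rewrite -f_im => /imsetP. Qed.

Lemma subrack_bij_memE (A : {set gT}) x :
  A \subset G -> x \in G -> (f x \in f @: A) = (x \in A).
Proof. exact: mem_imset_in. Qed.

Lemma card_subrack_bij (A : {set gT}) : A \subset G -> #|f @: A| = #|A|.
Proof. by move/subsetP=> sAG; apply: card_in_imset; apply: sub_in2 f_inj. Qed.

Lemma subrack_bij_sub (A : {set gT}) : A \subset G -> f @: A \subset H.
Proof. by rewrite -f_im; apply: imsetS. Qed.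

Lemma subrack_bij_pre (B : {set hT}) : B \subset H ->
  exists2 A : {set gT}, A \subset G & B = f @: A.
Proof.
move=> sBH; exists (G :&: f @^-1: B); first exact: subsetIl.
apply/setP=> y; apply/idP/imsetP => [By | [x]]; last first.
  by rewrite !inE => /andP[_ Bfx] ->.
have [x Gx def_y] := subrack_bij_surj (subsetP sBH y By).
by exists x; rewrite // !inE Gx -def_y.
Qed.

Lemma subrack_bij_cent1 x y :
  x \in G -> y \in G -> (f y \in 'C[f x]) = (y \in 'C[x]).
Proof.
move=> Gx Gy; rewrite -!set2_closedE -f_closed ?imsetU1 ?imset_set1 //.
by rewrite subUset !sub1set Gx.
Qed.

Lemma subrack_bij_subcent1 x : x \in G -> f @: 'C_G[x] = 'C_H[f x].
Proof.
move=> Gx; apply/setP=> y; apply/imsetP/setIP => [[z /setIP[Gz cxz] ->] | [Hy]].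
  by rewrite subrack_bij_mem // subrack_bij_cent1.
have [z Gz ->] := subrack_bij_surj Hy; rewrite subrack_bij_cent1 // => cxz.
by exists z; rewrite // inE Gz.
Qed.

Lemma subrack_bij_center : f @: 'Z(G) = 'Z(H).
Proof.
apply/setP=> y; apply/imsetP/idP => [[z /setIP[Gz cGz] ->] | /setIP[Hy cHy]].
  rewrite inE subrack_bij_mem //=; apply/centP=> _ /subrack_bij_surj[x Gx ->].
  by apply/esym/cent1P; rewrite subrack_bij_cent1 //; apply/cent1P/esym/(centP cGz).
have [z Gz def_y] := subrack_bij_surj Hy.
exists z; rewrite // inE Gz; apply/centP=> x Gx; apply/esym/cent1P.
rewrite -subrack_bij_cent1 // -def_y; apply/cent1P/esym/(centP cHy).
exact: subrack_bij_mem.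
Qed.

(* Unless [x ^: G] is [G], it has at most half of the elements; a proper subgroup
   generated by the image of its complement is thus equal to it, of index 2. *)
Lemma subrack_bij_class_compl x :
  x \in G -> H \subset 'N(f @: (G :\: x ^: G)).
Proof.
move=> Gx; set M := G :\: x ^: G.
have sMG : M \subset G by apply: subsetDl.
have nMG : G \subset 'N(M) by rewrite normsD ?normG ?class_norm.
have nfM : <<f @: M>> \subset 'N(f @: M).
  by rewrite gen_subG f_closed // (subset_trans sMG).
have sKH : <<f @: M>> \subset H by rewrite gen_subG subrack_bij_sub.
have [eqKH | neKH] := eqVneq <<f @: M>> H; first by rewrite -{1}eqKH.
have cH : #|H| = #|G| by rewrite -f_im card_subrack_bij.
have i1 : 1 < #|H : <<f @: M>>|.
  rewrite ltn_neqAle indexg_gt0 andbT eq_sym indexg_eq1.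
  by apply: contra neKH => sHK; rewrite eqEsubset sKH.
have cM : #|f @: M| = (#|G| - #|x ^: G|)%N.
  by rewrite card_subrack_bij // cardsD (setIidPr _) // class_subG.
have cK := Lagrange sKH; have cx := Lagrange (subcent1_sub x G).
rewrite index_cent1 in cx.
have [C1 | C_gt1] := leqP #|'C_G[x]| 1.
  suffices -> : f @: M = set0 by apply/subsetP=> h; rewrite inE conj0g.
  apply/eqP; rewrite -cards_eq0 cM -cx.
  have -> : #|'C_G[x]| = 1%N by apply/eqP; rewrite eqn_leq C1 cardG_gt0.
  by rewrite mul1n subnn.
have le2K : 2 * #|<<f @: M>>| <= #|G|.
  by rewrite -cH -cK mulnC leq_mul2l i1 orbT.
have le2C : 2 * #|x ^: G| <= #|G| by rewrite -cx leq_mul2r C_gt1 orbT.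
have eqfM : f @: M = <<f @: M>>.
  apply/eqP; rewrite eqEcard sub_gen //= cM.
  have half k m n : 2 * k <= n -> 2 * m <= n -> k <= n - m by lia.
  exact: half.
rewrite eqfM; apply: normal_norm; apply: index2_normal => //.
have cfM : #|<<f @: M>>| = (#|G| - #|x ^: G|)%N by rewrite -eqfM.
apply/eqP; rewrite -(eqn_pmul2l (cardG_gt0 <<f @: M>>)) cK.
have dbl k m n : 2 * k <= n -> 2 * m <= n -> k = (n - m)%N -> n == (k * 2)%N.
  by lia.
rewrite cH; exact: dbl cfM.
Qed.

(** If [f s ^ h = f t] with [s] in [S] and [t] outside, then [s] is not in the class of [t], so
    [f t] would lie in the normal set [f @: (G :\: t ^: G)]. *)
Lemma subrack_bij_norm (S : {set gT}) :
  S \subset G -> G \subset 'N(S) -> H \subset 'N(f @: S).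
Proof.
move=> sSG nSG; apply/subsetP=> h Hh; rewrite inE.
apply/subsetP=> _ /imsetP[_ /imsetP[s Ss ->] ->].
have Gs := subsetP sSG s Ss.
have [t Gt def_t] : exists2 t, t \in G & f s ^ h = f t.
  by apply: subrack_bij_surj; rewrite groupJ ?subrack_bij_mem.
have sMG : G :\: t ^: G \subset G by apply: subsetDl.
rewrite def_t subrack_bij_memE //; apply: contraTT (class_refl G t) => S't.
have : f s ^ h \in f @: (G :\: t ^: G).
  rewrite memJ_norm ?(subsetP (subrack_bij_class_compl Gt)) //.
  rewrite subrack_bij_memE // inE Gs andbT.
  apply: contra S't => /imsetP[g Gg def_s].
  by rewrite -(memJ_norm t (subsetP nSG g Gg)) -def_s.
by rewrite def_t subrack_bij_memE // inE => /andP[].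
Qed.

Lemma subrack_bij_subrack2 x y :
  x \in G -> y \in G -> f @: subrack2 x y = subrack2 (f x) (f y).
Proof.
move=> Gx Gy.
have sRG : subrack2 x y \subset G by rewrite sub_subrack2 ?normG.
have mem2 (hT' : finGroupType) (u v : hT') :
  (u \in subrack2 u v) && (v \in subrack2 u v) by rewrite !inE !class_refl orbT.
have /andP[Rx Ry] := mem2 _ x y; have /andP[Rfx Rfy] := mem2 _ (f x) (f y).
apply/eqP; rewrite eqEsubset andbC sub_subrack2 ?imset_f //=; last first.
  by rewrite f_closed ?subrack2_closed.
have sRH : subrack2 (f x) (f y) \subset H.
  by rewrite sub_subrack2 ?normG ?subrack_bij_mem.
have [T sTG defT] := subrack_bij_pre sRH; rewrite defT imsetS //.
have mT z : z \in G -> (z \in T) = (f z \in subrack2 (f x) (f y)).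
  by move=> Gz; rewrite defT subrack_bij_memE.
by rewrite sub_subrack2 ?mT // -f_closed // -defT subrack2_closed.
Qed.

(** [A] separates the two classes that make up [subrack2 g x]: that of [x] lies in [A], that of [g]
    avoids it. The same works for [f @: A], as a normal subset of [H]. *)
Lemma subrack_bij_orbit (A : {group gT}) g x :
  A <| G -> g \in G -> g \notin A -> x \in A ->
  f @: (g ^: <<[set g; x]>>) = f g ^: <<[set f g; f x]>>.
Proof.
move=> /andP[sAG nAG] Gg A'g Ax; have Gx := subsetP sAG x Ax.
have splitR (hT' : finGroupType) (K : {group hT'}) (C : {set hT'}) u v :
    u \in K -> v \in K -> u \notin C -> v \in C -> K \subset 'N(C) ->
  u ^: <<[set u; v]>> = subrack2 u v :\: C.
  move=> Ku Kv C'u Cv nCK.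
  have sLN : <<[set u; v]>> \subset 'N(C).
    by rewrite (subset_trans _ nCK) // gen_subG subUset !sub1set Ku.
  rewrite setDUl (setDidPl _); last first.
    rewrite disjoint_subset; apply/subsetP=> _ /imsetP[h Lh ->].
    by rewrite inE memJ_norm ?(subsetP sLN).
  by apply/esym/setUidPl; rewrite (_ : _ :\: _ = set0) ?sub0set //;
    apply/eqP; rewrite setD_eq0 class_sub_norm.
have f'fg : f g \notin f @: A by rewrite subrack_bij_memE.
have ffx : f x \in f @: A by apply: imset_f.
rewrite (splitR _ G A) // (splitR _ H (f @: A)) ?subrack_bij_mem //; last first.
  exact: subrack_bij_norm.
rewrite -subrack_bij_subrack2 //; apply/setP=> y; rewrite inE.
have sRG : subrack2 g x \subset G by rewrite sub_subrack2 ?normG.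
apply/imsetP/andP => [[z /setDP[Rz A'z] ->] | [fA'y /imsetP[z Rz def_y]]].
  by rewrite imset_f // subrack_bij_memE // (subsetP sRG).
exists z; rewrite // inE Rz andbT; apply: contra fA'y => Az.
by rewrite def_y imset_f.
Qed.

End SubrackBij.

(** * Orbits under two-generated subgroups *)

(** For abelian [B] normalised by [g], [L / 'C_B[g]] is the [<[g]>]-submodule of [B / 'C_B[g]]
    generated by the image of [y]. *)
Definition hull (gT : finGroupType) (B : {set gT}) (g y : gT) (L : {group gT}) :=
  [/\ 'C_B[g] \subset L, L \subset B, y \in L, g \in 'N(L)
    & forall L' : {group gT}, 'C_B[g] \subset L' -> L' \subset B -> y \in L' ->
      g \in 'N(L') -> L \subset L'].

(** Take [L = (K :&: B) * 'C_B[g]]. As [K] lies in [<[g]> * (K :&: B)], the orbit of [g] under [K]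
    is that under [K :&: B], with stabiliser [(K :&: B) :&: 'C_B[g]]; the second isomorphism theorem
    gives the index. *)
Lemma orbit_hull (gT : finGroupType) (B : {group gT}) g y :
    abelian B -> g \in 'N(B) -> y \in B ->
  exists2 L : {group gT}, hull B g y L
    & #|g ^: <<[set g; y]>>| = #|L : 'C_B[g]|.
Proof.
move=> cBB nBg By; set K := <<_>>.
have Kg : g \in K by rewrite mem_gen ?set21.
have Ky : y \in K by rewrite mem_gen ?set22.
have cgg : g \in 'C[g] by apply/cent1P.
have nKB : g \in 'N(K :&: B).
  by rewrite -sub1set normsI ?sub1set // (subsetP (normG _)).
have nCB : g \in 'N('C_B[g]).
  by rewrite -sub1set normsI ?sub1set // (subsetP (normG _)).
have decK (L : {group gT}) : y \in L -> g \in 'N(L) -> K \subset <[g]> * L.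
  move=> Ly nLg; rewrite -norm_joinEl ?cycle_subG // gen_subG subUset !sub1set.
  by rewrite mem_gen ?inE ?cycle_id // mem_gen // inE Ly orbT.
have cCKB : 'C_B[g] \subset 'C(K :&: B).
  by rewrite (subset_trans (subsetIl _ _)) // (subset_trans cBB) // centS ?subsetIr.
have defL : (K :&: B) <*> 'C_B[g] = (K :&: B) * 'C_B[g].
  by rewrite cent_joinEr.
exists [group of (K :&: B) <*> 'C_B[g]].
  split=> /=.
  - exact: joing_subr.
  - by rewrite join_subG subsetIr subsetIl.
  - by rewrite mem_gen // !inE Ky By.
  - by rewrite -sub1set normsY ?sub1set.
  (* Write [k = h * l] with [h] a power of [g]; as [k] and [l] are in [B], [h] is in ['C_B[g]],
     hence in [L']. *)
  move=> L' sCL' sL'B L'y nL'g; rewrite join_subG sCL' andbT.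
  apply/subsetP=> k /setIP[/(subsetP (decK L' L'y nL'g))/mulsgP[h l gh L'l ->] Bk].
  rewrite groupMr // (subsetP sCL') // inE -(groupMr _ (subsetP sL'B l L'l)) Bk.
  by rewrite (subsetP _ h gh) // cycle_subG.
have -> : g ^: K = g ^: (K :&: B).
  apply/eqP; rewrite eqEsubset andbC classS ?subsetIl //=.
  apply/subsetP=> _ /imsetP[k Kk ->].
  have KBy : y \in K :&: B by rewrite inE Ky.
  have /mulsgP[h l /cycleP[i ->] KBl ->] := subsetP (decK _ KBy nKB) k Kk.
  have -> : g ^ (g ^+ i * l) = g ^ l.
    by rewrite conjgM; congr (_ ^ l); apply/conjg_fixP/commgP/commuteX.
  exact: imset_f.
have defC : 'C_(K :&: B)[g] = (K :&: B) :&: 'C_B[g].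
  by rewrite setIA -(setIA K B B) setIid.
rewrite -index_cent1 defC indexgI.
apply/eqP; rewrite -(eqn_pmul2r (cardG_gt0 'C_B[g])) LagrangeMr -defL mulnC.
by rewrite Lagrange ?joing_subr.
Qed.

(** * Metacyclic groups *)

Lemma metacyclic_cycles (gT : finGroupType) (G : {group gT}) :
  metacyclic G -> exists a b, [/\ <[a]> <| G, b \in G & G :=: <[a]> * <[b]>].
Proof.
case/metacyclicP=> K [/cyclicP[a defK] nsKG /cyclicP[B defB]].
have [sKG nKG] := andP nsKG.
have: B \in G / K by rewrite defB cycle_id.
case/morphimP=> b Nb Gb defBb; exists a, b; rewrite -defK; split=> //.
apply/eqP; rewrite eqEsubset mul_subG ?cycle_subG // andbT.
by rewrite -quotientSK // quotient_cycle // -defBb -defB.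
Qed.

Section MetacyclicStructure.

Variables (gT : finGroupType) (G : {group gT}) (a b : gT).
Hypotheses (nsaG : <[a]> <| G) (Gb : b \in G) (defG : G :=: <[a]> * <[b]>).

Let A := 'C_G[a].
Let Z := 'Z(G).

Let Ga : a \in G. Proof. by rewrite -cycle_subG normal_sub. Qed.

Lemma metacyclic_gen2 : <<[set a; b]>> = G.
Proof.
apply/eqP; rewrite eqEsubset gen_subG subUset !sub1set Ga Gb /=.
by rewrite {1}defG mul_subG ?cycle_subG ?mem_gen ?set21 ?set22.
Qed.

Lemma metacyclic_centerE x : x \in G -> x \in 'C[a] -> x \in 'C[b] -> x \in Z.
Proof.
move=> Gx /cent1P cxa /cent1P cxb; rewrite inE Gx -metacyclic_gen2 cent_gen.
by apply/centP=> y; rewrite !inE => /orP[] /eqP->.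
Qed.

Let sZA : Z \subset A.
Proof.
by rewrite subsetI subsetIl (subset_trans (subsetIr _ _)) // -cent_set1 centS ?sub1set.
Qed.

(** If [a ^+ i * b ^+ j] commutes with [a], then [b ^+ j] commutes with both generators. *)
Lemma metacyclic_cent1E : A = <[a]> * Z.
Proof.
apply/eqP; rewrite eqEsubset mul_subG //; last first.
  by rewrite cycle_subG inE Ga; apply/cent1P.
rewrite andbT; apply/subsetP=> x /setIP[]; rewrite defG.
case/mulsgP=> h k /cycleP[i ->] /cycleP[j ->] -> cax.
rewrite mem_mulg ?mem_cycle //; apply: metacyclic_centerE.
- by rewrite groupX.
- by rewrite -(groupMl _ (_ : a ^+ i \in _)) // groupX //; apply/cent1P.
- by rewrite groupX //; apply/cent1P.
Qed.

Lemma metacyclic_cent1_abelian : abelian A.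
Proof.
rewrite metacyclic_cent1E abelianM cycle_abelian center_abelian.
by rewrite (subset_trans (subsetIr _ _)) // centS // cycle_subG.
Qed.

Lemma metacyclic_cent1_normal : A <| G.
Proof.
by rewrite /A -cent_cycle; apply: norm_normalI; rewrite norms_cent ?normal_norm.
Qed.

Lemma metacyclic_cent1_center : 'C_A[b] = Z.
Proof.
apply/eqP; rewrite eqEsubset; apply/andP; split; apply/subsetP=> x.
  by case/setIP=> /setIP[Gx cax] cbx; apply: metacyclic_centerE.
move=> Zx; rewrite inE (subsetP sZA) //=.
by case/centerP: Zx => _ /(_ b Gb)/cent1P.
Qed.

(** Modulo [Z], [x] is a power of [a], and subgroups of the cyclic normal subgroup [<[a]>] are
    normal in [G]. *)
Lemma metacyclic_cycle_norm x : x \in A -> G \subset 'N(<[x]> <*> Z).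
Proof.
rewrite metacyclic_cent1E => /mulsgP[_ z /cycleP[i ->] Zz ->].
suffices -> : <[a ^+ i * z]> <*> Z = <[a ^+ i]> <*> Z.
  have chai : <[a ^+ i]> \char <[a]>.
    by rewrite sub_cyclic_char ?cycle_cyclic // cycle_subG mem_cycle.
  by rewrite normsY ?gFnorm // normal_norm ?(char_normal_trans chai).
apply/eqP; rewrite eqEsubset !join_subG !joing_subr !andbT !cycle_subG.
have ZY y : z \in <[y]> <*> Z by rewrite (subsetP (joing_subr _ _)).
rewrite groupMr ?ZY // (subsetP (joing_subl _ _)) ?cycle_id //=.
by rewrite -(groupMr _ (ZY _)) (subsetP (joing_subl _ _)) ?cycle_id.
Qed.

Let nZ x : x \in G -> x \in 'N(Z).
Proof. by apply: subsetP; rewrite gFnorm. Qed.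

Let sAG : A \subset G. Proof. exact: subsetIl. Qed.

Lemma card_cycle_center x : x \in G -> #|<[x]> <*> Z : Z| = #[coset Z x].
Proof.
move=> Gx; rewrite -card_quotient ?join_subG ?cycle_subG ?nZ ?normG //.
by rewrite quotientYidr ?quotient_cycle ?cycle_subG ?nZ.
Qed.

Lemma order_coset_center x m :
  x \in G -> (#[coset Z x] %| m) = (x ^+ m \in Z).
Proof.
move=> Gx; rewrite order_dvdn -morphX ?nZ //.
by apply/eqP/idP => [/coset_idr-> | /coset_id] //; rewrite nZ // groupX.
Qed.

(** Since [<[x]> <*> Z] is [b]-stable, it is the hull of [x]. *)
Lemma metacyclic_orbit x : x \in A ->
  #|b ^: <<[set b; x]>>| = #[coset Z x].
Proof.
move=> Ax; have Gx := subsetP sAG x Ax.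
have nAb : b \in 'N(A) by rewrite (subsetP (normal_norm metacyclic_cent1_normal)).
have [L [sCL sLA Lx nLb minL] ->] :=
  orbit_hull metacyclic_cent1_abelian nAb Ax.
rewrite metacyclic_cent1_center -card_cycle_center //; congr #|_ : _|.
apply/eqP; rewrite eqEsubset join_subG cycle_subG Lx.
rewrite -{2}metacyclic_cent1_center sCL andbT minL //=.
- by rewrite metacyclic_cent1_center joing_subr.
- by rewrite join_subG cycle_subG Ax sZA.
- by rewrite (subsetP (joing_subl _ _)) ?cycle_id.
- by rewrite (subsetP (metacyclic_cycle_norm Ax)).
Qed.

Lemma index_metacyclic_cent1 : #|A : Z| = #[coset Z a].
Proof.
rewrite -card_cycle_center // metacyclic_cent1E cent_joinEr //.
by rewrite (subset_trans (subsetIr _ _)) // centS // cycle_subG.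
Qed.

(** The coset of [a] generates the cyclic group [A / Z]; for [m] dividing its order, this power of
    [a] generates the subgroup of order [m]. *)
Definition center_root (m : nat) := a ^+ (#|A : Z| %/ m).

Lemma center_root_in m : center_root m \in A.
Proof. by rewrite groupX // inE Ga; apply/cent1P. Qed.

Lemma order_center_root m : m %| #|A : Z| -> #[coset Z (center_root m)] = m.
Proof.
rewrite /center_root index_metacyclic_cent1 => dvm.
rewrite morphX ?nZ //= orderXdiv ?dvdn_div //.
by rewrite divnA // mulKn // order_gt0.
Qed.

Lemma center_root_gen m : m %| #|A : Z| ->
  [set x in A | x ^+ m \in Z] = <[center_root m]> <*> Z.
Proof.
move=> dvm; have m_gt0 : 0 < m by apply: dvdn_gt0 dvm; apply: indexg_gt0.
have Ac := center_root_in m; have Gc := subsetP sAG _ Ac.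
have expZ y z : y \in G -> z \in Z -> ((y * z) ^+ m \in Z) = (y ^+ m \in Z).
  move=> Gy Zz; rewrite expgMn ?(groupMr _ (groupX m Zz)) //.
  by case/centerP: Zz => _ /(_ y Gy)/commute_sym.
apply/eqP; rewrite eqEsubset; apply/andP; split; last first.
  rewrite cent_joinEr; last first.
    by rewrite (subset_trans (subsetIr _ _)) // centS // cycle_subG.
  apply/subsetP=> _ /mulsgP[_ z /cycleP[i ->] Zz ->].
  apply/setIdP; split; first by rewrite (groupM (groupX i Ac)) // (subsetP sZA).
  rewrite (expZ _ _ (groupX i Gc) Zz) -expgM mulnC expgM groupX //.
  by rewrite -order_coset_center // order_center_root.
apply/subsetP=> x; rewrite inE metacyclic_cent1E => /andP[].
case/mulsgP=> _ z /cycleP[i ->] Zz -> Zm.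
rewrite (expZ _ _ (groupX i Ga) Zz) in Zm.
rewrite groupMr ?(subsetP (joing_subr _ _) z) //.
move: Zm; rewrite -expgM -order_coset_center // -index_metacyclic_cent1.
rewrite -(divnK dvm) dvdn_pmul2r // => /dvdnP[k ->].
by rewrite mulnC expgM (subsetP (joing_subl _ _)) // mem_cycle.
Qed.

Lemma card_center_root m : m %| #|A : Z| ->
  #|[set x in A | x ^+ m \in Z]| = (#|Z| * m)%N.
Proof.
move=> dvm; have Gc := subsetP sAG _ (center_root_in m).
rewrite center_root_gen // -[X in (_ * X)%N](order_center_root dvm).
by rewrite -card_cycle_center // Lagrange ?joing_subr.
Qed.

End MetacyclicStructure.

(** * Unipotent and scalar actions on abelian p-groups *)

(** Powers of a Jordan block of size two with eigenvalue [c]. At [j = 0] the factor [j] hides the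
    truncated [j.-1]. *)
Lemma conjg_expg_scalar (gT : finGroupType) (b y w : gT) c j :
  commute y w -> y ^ b = y ^+ c * w -> w ^ b = w ^+ c ->
  y ^ (b ^+ j) = y ^+ (c ^ j)%N * w ^+ (j * c ^ j.-1)%N.
Proof.
move=> cyw yb wb; elim: j => [|j IHj].
  by rewrite conjg1 mul0n expn0 mulg1.
rewrite expgSr conjgM IHj conjMg !conjXg yb wb expgMn; last first.
  exact/commute_sym/commuteX/commute_sym.
rewrite -!expgM -mulgA -expgD -expnS mulSn; congr (_ * _ ^+ (_ + _)).
by case: j {IHj} => [|j]; rewrite ?muln0 // expnS mulnCA.
Qed.

(** Powers of a unipotent Jordan block of size three. *)
Lemma conjg_expg_unipotent (gT : finGroupType) (b y w z : gT) j :
  commute w z -> y ^ b = y * w -> w ^ b = w * z -> z ^ b = z ->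
  y ^ (b ^+ j) = y * w ^+ j * z ^+ 'C(j, 2).
Proof.
move=> cwz yb wb zb; elim: j => [|j IHj].
  by rewrite conjg1 !mulg1.
rewrite expgSr conjgM IHj !conjMg !conjXg yb wb zb expgMn // binS bin1.
by rewrite addnC expgS expgD !mulgA.
Qed.

Lemma index_cycle_joing (gT : finGroupType) (K : {group gT}) x m :
  x \in 'N(K) -> x ^+ m \in K -> #|<[x]> <*> K : K| %| m.
Proof.
move=> nKx Kxm; rewrite -card_quotient ?join_subG ?cycle_subG ?nKx ?normG //.
rewrite quotientYidr ?cycle_subG // quotient_cycle // -[#|_|]/(#[_]) order_dvdn.
by rewrite -morphX //= coset_id.
Qed.

Lemma prime_index_eq (gT : finGroupType) (Z K Y : {group gT}) y :
  Z \subset K -> K \subset Y -> prime #|Y : Z| -> y \in K -> y \notin Z ->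
  K :=: Y.
Proof.
move=> sZK sKY pr_i Ky Z'y; apply/eqP; rewrite eqEsubset sKY -indexg_eq1.
have/primeP[_ /(_ #|K : Z|)] := pr_i.
rewrite -(Lagrange_index sKY sZK) dvdn_mull // => /(_ isT)/orP[].
  by rewrite indexg_eq1 => /subsetP/(_ y Ky); rewrite (negPf Z'y).
by rewrite -[X in X == _]mul1n eqn_pmul2r // eq_sym => /eqP->.
Qed.

(** Let [c] be the eigenvalue on [E1]. The map [psi], additively [b - c], kills [E1] and commutes
    with [b], so its image is cyclic and [b]-stable. If not inside [E1], it would be all of [E],
    which is not cyclic. *)
Lemma uniserial_eigenvalue (gT : finGroupType) (E E1 : {group gT}) b p :
    prime p -> p.-abelem E -> #|E| = (p ^ 2)%N -> E1 \subset E -> #|E1| = p ->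
    b \in 'N(E) -> b \in 'N(E1) ->
    (forall L : {group gT}, L \subset E -> b \in 'N(L) -> ~~ (L \subset E1) ->
       L :=: E) ->
  exists c, (forall w, w \in E1 -> w ^ b = w ^+ c)
         /\ (forall y, y \in E -> (y ^+ c)^-1 * y ^ b \in E1).
Proof.
move=> pr_p abelE oE sE1E oE1 nEb nE1b genE.
have [pE cEE expE] : [/\ p.-group E, abelian E & forall y, y \in E -> y ^+ p = 1].
  by case/and3P: (abelE) => pE cEE /exponentP.
have [e defE1] : exists e, E1 :=: <[e]>.
  by apply/cyclicP; rewrite prime_cyclic ?oE1.
have E1e : e \in E1 by rewrite defE1 cycle_id.
have [c eb] : exists c, e ^ b = e ^+ c.
  by apply/cycleP; rewrite -defE1 memJ_norm.
have E1b w : w \in E1 -> w ^ b = w ^+ c.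
  rewrite {1}defE1 => /cycleP[k ->].
  by rewrite conjXg eb -!expgM mulnC.
exists c; split=> // y Ey; apply: contraTT isT => E1'y.
pose psi t := (t ^+ c)^-1 * t ^ b.
have Epsi t : t \in E -> psi t \in E.
  by move=> Et; rewrite groupM ?groupV ?groupX ?memJ_norm.
have psiM t u : t \in E -> u \in E -> psi (t * u) = psi t * psi u.
  move=> Et Eu; rewrite /psi conjMg expgMn; last exact: (centsP cEE).
  have cut : commute (u ^+ c)^-1 (psi t).
    by apply: (centsP cEE); rewrite ?Epsi // groupV groupX.
  by rewrite invMg -mulgA (mulgA _ (t ^ b)) -/(psi t) mulgA cut -mulgA.
have psiX t k : t \in E -> psi (t ^+ k) = psi t ^+ k.
  move=> Et; elim: k => [|k IHk]; first by rewrite /psi conj1g !mulg1 expg1n invg1.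
  by rewrite !expgS psiM ?groupX ?IHk.
have psiE1 t : t \in E1 -> psi t = 1 by move=> E1t; rewrite /psi E1b ?mulVg.
have psiJ t : t \in E -> psi t ^ b = psi (t ^ b).
  by move=> Et; rewrite /psi conjMg conjVg conjXg.
have E1'y0 : y \notin E1.
  by apply: contra E1'y => E1y; rewrite -/(psi y) psiE1.
have defE : <[y]> * E1 = E.
  have sYE : <[y]> \subset E by rewrite cycle_subG.
  apply/eqP; rewrite eqEcard mul_subG //= oE TI_cardMg ?oE1.
    rewrite -[#|<[y]>|]/#[y] (abelem_order_p abelE) ?mulnn //.
    by apply: contraNneq E1'y0 => ->.
  rewrite setIC; apply: prime_TIg; first by rewrite oE1.
  apply: contra E1'y0 => sE1y; rewrite -cycle_subG -(_ : E1 :=: <[y]>) //.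
  apply/eqP; rewrite eqEcard sE1y oE1 dvdn_leq ?prime_gt0 //.
  by rewrite -[#|<[y]>|]/#[y] order_dvdn expE.
have [k psi_y] : exists k, psi y ^ b = psi y ^+ k.
  have: y ^ b \in <[y]> * E1 by rewrite defE memJ_norm.
  case/mulsgP=> _ t /cycleP[k ->] E1t yb; exists k.
  have Et := subsetP sE1E t E1t.
  by rewrite psiJ // yb (psiM _ _ (groupX k Ey) Et) psiX // (psiE1 t) // mulg1.
have eqE : <[psi y]> = E.
  apply: genE; rewrite ?cycle_subG ?Epsi //.
  rewrite inE; apply/subsetP=> _ /imsetP[_ /cycleP[m ->] ->].
  by rewrite conjXg psi_y -expgM mem_cycle.
have: #[psi y] %| p by rewrite order_dvdn expE ?Epsi.
rewrite -[#[_]]/#|<[_]>| eqE oE => /dvdn_leq-/(_ (prime_gt0 pr_p)).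
by rewrite leqNgt -{1}(expn1 p) ltn_exp2l // prime_gt1.
Qed.

(** * A [b]-uniserial section [Y / Z] of order p^2 and exponent p *)

Section UniserialBlock.

Variables (gT : finGroupType) (Y Y1 Z : {group gT}) (b : gT) (p : nat).
Hypotheses (pr_p : prime p) (cYY : abelian Y).
Hypotheses (sZY1 : Z \subset Y1) (sY1Y : Y1 \subset Y).
Hypotheses (nYb : b \in 'N(Y)) (nY1b : b \in 'N(Y1)) (defZ : 'C_Y[b] = Z).
Hypotheses (iY : #|Y : Z| = (p ^ 2)%N) (iY1 : #|Y1 : Z| = p).
Hypothesis expY : forall y, y \in Y -> y ^+ p \in Z.
Hypothesis genY : forall (L : {group gT}) y, Z \subset L -> L \subset Y ->
  b \in 'N(L) -> y \in L -> y \notin Y1 -> Y \subset L.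

Let sZY : Z \subset Y. Proof. exact: subset_trans sY1Y. Qed.
Let nZY : Y \subset 'N(Z). Proof. exact: sub_abelian_norm. Qed.
Let nZb : b \in 'N(Z).
Proof.
by rewrite -defZ -sub1set normsI ?sub1set // (subsetP (normG _)) // cent1id.
Qed.
Let memZ y : y \in Y -> y ^ b = y -> y \in Z.
Proof. by move=> Yy /conjg_fixP/commgP cyb; rewrite -defZ inE Yy; apply/cent1P. Qed.
Let Zfix z : z \in Z -> z ^ b = z.
Proof. by rewrite -defZ => /setIP[_ /cent1P/commgP/conjg_fixP]. Qed.

Lemma block_centX n : b \in 'N('C_Y[b ^+ n]).
Proof.
rewrite -sub1set normsI ?sub1set // (subsetP (normG _)) //.
by rewrite cent1C groupX ?cent1id.
Qed.

Lemma block_eigenvalue : exists c,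
    (forall w, w \in Y1 -> coset Z (w ^ b) = coset Z w ^+ c)
 /\ (forall y, y \in Y -> (coset Z y ^+ c)^-1 * coset Z (y ^ b) \in Y1 / Z).
Proof.
have nE (K : {group gT}) : Z \subset K -> K \subset Y -> b \in 'N(K) ->
    coset Z b \in 'N(K / Z).
  by move=> sZK sKY nKb; rewrite (subsetP (quotient_norm _ _)) // mem_quotient.
have [|||||||L sLE nLb nsLE1|c [cE1 cE]] :=
  @uniserial_eigenvalue _ (Y / Z)%G (Y1 / Z)%G (coset Z b) p => //.
- rewrite abelemE // quotient_abelian //=; apply/exponentP=> _ /morphimP[y Ny Yy ->].
  by rewrite -morphX //= coset_id ?expY.
- by rewrite card_quotient.
- exact: quotientS.
- by rewrite card_quotient // (subset_trans sY1Y).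
- exact: nE.
- exact: nE.
- have sL'Y : coset Z @*^-1 L \subset Y by rewrite sub_cosetpre_quo // /normal sZY.
  have nL'b : b \in 'N(coset Z @*^-1 L).
    rewrite inE; apply/subsetP=> _ /imsetP[t /morphpreP[Nt Lt] ->].
    by apply/morphpreP; split; rewrite ?groupJ // morphJ // memJ_norm.
  have /subsetPn[t L't Y1't] : ~~ (coset Z @*^-1 L \subset Y1).
    by apply: contra nsLE1 => sL'Y1; rewrite -(cosetpreK L) quotientS.
  apply/eqP; rewrite eqEsubset sLE -(cosetpreK L) quotientS //.
  by apply: (genY _ _ _ L't) => //; apply: sub_cosetpre.
exists c; split=> [w Y1w | y Yy].
  have Nw := subsetP nZY w (subsetP sY1Y w Y1w).
  by rewrite morphJ //= cE1 // mem_quotient.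
by rewrite morphJ ?(subsetP nZY y) //; apply: cE; apply: mem_quotient.
Qed.

(** The cases are [c] different from and equal to [1] modulo [p], for the eigenvalue [c]. In the
    first, [b ^+ p] acts on [Y / Z] as the scalar [c ^ p]; in the second, [y], [w = [~ y, b]] and [z
    = [~ w, b]] form a unipotent Jordan block. *)
Lemma block_cases :
   (forall y, y \in Y -> y ^ (b ^+ p) \in <[y]> <*> Z) /\ 'C_Y[b ^+ p] \subset Z
 \/ forall y, y \in Y -> y \notin Y1 -> exists w z,
     [/\ w \in Y1, w \notin Z, z \in Z & z != 1] /\
     [/\ y ^ b = y * w, w ^ b = w * z, w ^+ p = 1 & z ^+ p = 1].
Proof.
have [c [Y1b Yb]] := block_eigenvalue.
have Ny y : y \in Y -> y \in 'N(Z) by apply: subsetP.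
have sY1 y : y \in Y1 -> y \in Y by apply: subsetP.
have expE y : y \in Y -> coset Z y ^+ p = 1.
  by move=> Yy; rewrite -morphX ?Ny //= coset_id ?expY.
have YJ y : y \in Y -> y ^ b \in Y by move=> Yy; rewrite memJ_norm.
have nZY1 : Z <| Y1 by rewrite /normal sZY1 (subset_trans sY1Y).
have index_le y : y \in Y -> y \notin Y1 -> ~~ (Y \subset <[y]> <*> Z).
  move=> Yy Y1'y; apply/negP=> sYK.
  have := index_cycle_joing (Ny y Yy) (expY Yy).
  have -> : #|<[y]> <*> Z : Z| = (p ^ 2)%N.
    rewrite -iY; congr #|_ : _|; apply/eqP.
    by rewrite eqEsubset sYK join_subG cycle_subG Yy sZY.
  move/(dvdn_leq (prime_gt0 pr_p)); apply/negP.
  by rewrite -ltnNge -{1}(expn1 p) ltn_exp2l // prime_gt1.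
have [c1 | c'1] := eqVneq (c %% p) 1%N; [right | left]; last split.
- move=> y Yy Y1'y.
  have coset_c t : t \in Y -> coset Z t ^+ c = coset Z t.
    by move=> Yt; rewrite -(expg_mod c (expE t Yt)) c1.
  pose w := y^-1 * y ^ b; pose z := w^-1 * w ^ b.
  have yb : y ^ b = y * w by rewrite mulKVg.
  have wb : w ^ b = w * z by rewrite mulKVg.
  have Yw : w \in Y by rewrite groupM ?groupV ?YJ.
  have Y1w : w \in Y1.
    have: coset Z w \in Y1 / Z.
      by rewrite morphM ?morphV ?Ny ?groupV ?YJ //= -[X in X^-1]coset_c ?Yb.
    by move=> E1w; rewrite -(quotientGK nZY1) mem_morphpre ?Ny.
  (* Otherwise [<[y]> <*> Z] would be [b]-stable, hence contain [Y], although its index over [Z]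
     divides [p]. *)
  have Z'w : w \notin Z.
    apply: contra (index_le y Yy Y1'y) => Zw; apply: (genY _ _ _ _ Y1'y).
    - exact: joing_subr.
    - by rewrite join_subG cycle_subG Yy.
    - rewrite inE conjYg join_subG -cycleJ cycle_subG yb.
      have Kw : w \in <[y]> <*> Z by rewrite (subsetP (joing_subr _ _)).
      rewrite groupM //= ?(subsetP (joing_subl _ _)) ?cycle_id //.
      by rewrite (normP nZb) joing_subr.
    - by rewrite (subsetP (joing_subl _ _)) ?cycle_id.
  have Yz : z \in Y by rewrite groupM ?groupV ?YJ.
  have Zz : z \in Z.
    apply: coset_idr; first exact: Ny.
    by rewrite morphM ?morphV ?Ny ?groupV ?YJ //= Y1b // coset_c ?mulVg.
  (* [b] fixes [t ^+ p] and sends it to [(t * s) ^+ p = t ^+ p * s ^+ p]. *)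
  have expJ t s : t \in Y -> s \in Y -> t ^ b = t * s -> t ^+ p \in Z -> s ^+ p = 1.
    move=> Yt Ys tb Ztp; apply: (mulgI (t ^+ p)); rewrite mulg1.
    rewrite -expgMn; last exact: (centsP cYY).
    by rewrite -tb -conjXg Zfix.
  exists w, z; split; split=> //.
  - apply: contra Z'w => /eqP z1; apply: memZ => //.
    by rewrite wb z1 mulg1.
  - by apply: (expJ y) => //; apply: expY.
  - by apply: (expJ w) => //; apply: expY.
- move=> y Yy.
  pose w := (coset Z y ^+ c)^-1 * coset Z (y ^ b).
  have E1w : w \in Y1 / Z by apply: Yb.
  have Jb t : t \in Y -> coset Z (t ^ b) = coset Z t ^ coset Z b.
    by move=> Yt; rewrite morphJ ?(Ny t).
  have [wb wp cyw] : [/\ w ^ coset Z b = w ^+ c, w ^+ p = 1 & commute (coset Z y) w].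
    case/morphimP: E1w => t Nt Y1t ->; have Yt := sY1 t Y1t.
    split; rewrite /= -?Jb ?Y1b ?expE //.
    by rewrite /commute -!morphM ?Ny //= (centsP cYY).
  have yb : coset Z y ^ coset Z b = coset Z y ^+ c * w by rewrite -Jb // mulKVg.
  have := conjg_expg_scalar p cyw yb wb.
  (* The off-diagonal exponent is a multiple of [p], so [w] disappears. *)
  rewrite (expgM w) wp expg1n mulg1 -morphX //= -morphJ ?groupX ?(Ny y) //=.
  set k := (c ^ p)%N; rewrite -morphX ?Ny //=.
  move/(congr1 (fun A => A * (coset Z (y ^+ k))^-1)).
  have NJ : y ^ (b ^+ p) \in 'N(Z) by rewrite groupJ ?groupX ?(Ny y).
  have Nyk : y ^+ k \in 'N(Z) by rewrite groupX ?Ny.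
  rewrite mulgV -morphV //= -morphM ?groupV //.
  move/coset_idr; rewrite groupM ?groupV // => /(_ isT) Zt.
  rewrite -(mulgKV (y ^+ k) (y ^ (b ^+ p))) groupM //.
    by rewrite (subsetP (joing_subr _ _)).
  by rewrite groupX // (subsetP (joing_subl _ _)) ?cycle_id.
have cE1 w : w \in Y1 -> coset Z (w ^ (b ^+ p)) = coset Z w ^+ (c ^ p).
  move=> Y1w; have Yw := sY1 w Y1w.
  have wb : coset Z w ^ coset Z b = coset Z w ^+ c * 1.
    by rewrite mulg1 -Y1b // morphJ ?(Ny w).
  have := conjg_expg_scalar p (commute1 _) wb.
  rewrite !conj1g !expg1n mulg1 => /(_ erefl) <-.
  by rewrite -morphX //= -morphJ ?groupX ?(Ny w).
(* A fixed point of [b ^+ p] outside [Z] forces [Y1] to be centralised; then [c ^ p] is [1] modulo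
   [p], and so is [c] by Fermat. *)
apply/subsetP=> y /setIP[Yy cby]; apply: contraR c'1 => Z'y.
have CY1 : Y1 \subset 'C_Y[b ^+ p].
  have sZC : Z \subset 'C_Y[b ^+ p].
    rewrite -[in X in X \subset _]defZ setIS //; apply/subsetP=> t.
    by rewrite !(cent1C t) => cbt; rewrite groupX.
  have [Y1y | Y1'y] := boolP (y \in Y1); last first.
    rewrite (subset_trans sY1Y) // (genY _ _ _ _ Y1'y) ?subsetIl ?block_centX //.
    by apply/setIP.
  rewrite -(@prime_index_eq _ Z (Y1 :&: 'C_Y[b ^+ p])%G Y1 y) ?subsetIl ?subsetIr //=.
  - by rewrite subsetI sZY1.
  - by rewrite iY1.
  - by apply/setIP; split=> //; apply/setIP.
have [w Y1w Z'w] : exists2 w, w \in Y1 & w \notin Z.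
  apply/subsetPn; rewrite -indexg_eq1 iY1.
  by apply: contraL (prime_gt1 pr_p) => /eqP->.
have := cE1 w Y1w; have /setIP[Yw /cent1P/commgP/conjg_fixP->] := subsetP CY1 w Y1w.
rewrite -[LHS]expg1 => /eqP; rewrite eq_expg_mod_order.
have -> : #[coset Z w] = p.
  apply: nt_prime_order; rewrite ?expE //; apply: contra Z'w => /eqP/coset_idr-> //.
  exact: Ny.
by rewrite fermat_little // modn_small ?prime_gt1 // eq_sym.
Qed.

Lemma block_conjX y w z j : w \in Y -> z \in Z ->
    y ^ b = y * w -> w ^ b = w * z ->
  y ^ (b ^+ j) = y * w ^+ j * z ^+ 'C(j, 2) /\ w ^ (b ^+ j) = w * z ^+ j.
Proof.
move=> Yw Zz yb wb; have Yz := subsetP sZY z Zz.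
split; first exact: (conjg_expg_unipotent j (centsP cYY w Yw z Yz) yb wb (Zfix Zz)).
have := conjg_expg_unipotent j (commute1 z) wb _ (conj1g b).
by rewrite expg1n !mulg1; apply; apply: Zfix.
Qed.

(** If [p] divides [j], then, being odd, it divides ['C(j, 2)], and the powers of [w] and [z]
    vanish. Otherwise [b ^+ j] moves [w], while a centraliser not inside [Z] would contain [Y1]. *)
Lemma block_odd y w z j : odd p -> w \in Y1 -> w \notin Z -> z \in Z -> z != 1 ->
    y ^ b = y * w -> w ^ b = w * z -> w ^+ p = 1 -> z ^+ p = 1 ->
  y ^ (b ^+ j) = y \/ 'C_Y[b ^+ j] \subset Z.
Proof.
move=> odd_p Y1w Z'w Zz nz1 yb wb wp zp.
have [yj wj] := block_conjX j (subsetP sY1Y w Y1w) Zz yb wb.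
have [dv_pj | ndv_pj] := boolP (p %| j); [left | right].
  have dv_pC : p %| 'C(j, 2).
    have := bin_ffact j 2; rewrite !ffactnS ffactn0 muln1 => eqC.
    rewrite -(@Gauss_dvdl _ _ 2`!) ?eqC ?dvdn_mulr //.
    by rewrite coprimen2.
  have kill (t : gT) n : p %| n -> t ^+ p = 1 -> t ^+ n = 1.
    by move=> /dvdnP[k ->] tp; rewrite mulnC expgM tp expg1n.
  by rewrite yj (kill w j) ?(kill z _ dv_pC) ?mulg1.
apply/subsetP=> t /setIP[Yt cbt]; apply: contraR nz1 => Z't.
have sZC : Z \subset 'C_Y[b ^+ j].
  rewrite -[in X in X \subset _]defZ setIS //; apply/subsetP=> s.
  by rewrite !(cent1C s) => cbs; rewrite groupX.
have /setIP[_ /cent1P/commgP/conjg_fixP] : w \in 'C_Y[b ^+ j].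
  have [Y1t | Y1't] := boolP (t \in Y1).
    have eqY1 : Y1 :&: 'C_Y[b ^+ j] = Y1.
      apply: (@prime_index_eq _ Z (Y1 :&: 'C_Y[b ^+ j])%G Y1 t).
      - by rewrite subsetI sZY1.
      - exact: subsetIl.
      - by rewrite iY1.
      - by apply/setIP; split=> //; apply/setIP.
      - by [].
    by have := Y1w; rewrite -[in X in X -> _]eqY1 => /setIP[].
  apply: (subsetP _ w (subsetP sY1Y w Y1w)).
  by rewrite (genY _ _ _ _ Y1't) ?subsetIl ?block_centX //; apply/setIP.
rewrite wj -[RHS]mulg1 => /mulgI zj1.
have: #[z] %| gcdn j p by rewrite dvdn_gcd !order_dvdn zj1 zp !eqxx.
have /eqP-> : coprime j p by rewrite coprime_sym prime_coprime.
by rewrite dvdn1 order_eq1.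
Qed.

End UniserialBlock.

(** * A cyclic block: [x] of order p^2 modulo the centraliser of [b] *)

Section CyclicBlock.

Variables (gT : finGroupType) (b x : gT) (p : nat).
Hypotheses (pr_p : prime p) (nxb : b \in 'N(<[x]>)).
Hypothesis xZ : forall m, (x ^+ m \in 'C[b]) = (p ^ 2 %| m).
Hypothesis orb_fix :
  exists2 c, c \in b ^: <<[set b; x]>> & (c != b) && (c \in 'C[b]).
Hypothesis orb_move : exists2 c, c \in b ^: <<[set b; x]>> & c \notin 'C[b].

Lemma cyclic_block_orbit c : c \in b ^: <<[set b; x]>> -> exists k, c = b ^ (x ^+ k).
Proof.
case/imsetP=> h Kh ->.
have: h \in <[b]> * <[x]>.
  rewrite -norm_joinEl ?cycle_subG // joing_idl joing_idr.
  by [].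
case/mulsgP=> _ _ /cycleP[i ->] /cycleP[k ->] ->; exists k.
by rewrite conjgM; congr (_ ^ _); apply/conjg_fixP/commgP/commuteX.
Qed.

(* [u = x^-1 x^b = x ^+ i], so that [u ^ b = u ^+ i.+1]. *)
Lemma cyclic_block_conj : exists u i,
  [/\ #[u] = (p ^ 2)%N, commute x u, p %| i, ~~ (p ^ 2 %| i)
    & forall j, x ^ (b ^+ j) = x * u ^+ (j + i * 'C(j, 2))].
Proof.
have [i def_u] : exists i, x^-1 * x ^ b = x ^+ i.
  apply/cycleP; rewrite groupM ?groupV ?cycle_id //.
  by rewrite -cycle_subG cycleJ (normP nxb).
pose u := x ^+ i; have xb : x ^ b = x * u by rewrite /u -def_u mulKVg.
have cxu : commute x u by apply: commuteX.
have xmb m : (x ^+ m) ^ b = x ^+ m * u ^+ m by rewrite conjXg xb expgMn.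
have cent_b t : (t \in 'C[b]) = (t ^ b == t).
  by apply/cent1P/eqP => [/commgP/conjg_fixP | /conjg_fixP/commgP].
(* [u ^+ m] is the commutator of [x ^+ m] and [b]. *)
have u_eq1 m : (u ^+ m == 1) = (p ^ 2 %| m).
  by rewrite -xZ cent_b xmb -{2}[x ^+ m]mulg1 (inj_eq (mulgI _)).
have oru : #[u] = (p ^ 2)%N.
  apply/eqP; rewrite eqn_dvd order_dvdn u_eq1 dvdnn /=.
  by rewrite -u_eq1 expg_order.
have ub : u ^ b = u * u ^+ i by rewrite {1}/u xmb.
have orb_k k : ((b ^ (x ^+ k)) \in 'C[b]) = (u ^+ k \in 'C[b]).
  have -> : b ^ (x ^+ k) = b * (u ^+ k)^-1.
    rewrite -(mulKg (x ^+ k) (u ^+ k)) -xmb !conjgE !invMg !invgK !mulgA.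
    by rewrite mulgV mul1g.
  by rewrite groupMl ?cent1id // groupV.
have orb_1 k : (b ^ (x ^+ k) == b) = (p ^ 2 %| k).
  by rewrite -xZ cent1C; apply/eqP/cent1P => [/conjg_fixP/commgP | /commgP/conjg_fixP].
have ukb k : (u ^+ k) ^ b = u ^+ k * u ^+ (i * k).
  by rewrite conjXg ub expgMn ?expgM //; apply: commuteX.
have uk_cent k : (u ^+ k \in 'C[b]) = (p ^ 2 %| i * k).
  by rewrite cent_b ukb -u_eq1 -[X in _ == X]mulg1 (inj_eq (mulgI _)).
(* If [p] did not divide [i], the only element of the orbit commuting with [b] would be [b]. *)
have dv_i : p %| i.
  case: orb_fix => c /cyclic_block_orbit[k ->]; rewrite orb_1 orb_k uk_cent.
  case/andP=> ndv_k dv_ik; apply: contraR ndv_k => ndv_i.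
  by rewrite -(@Gauss_dvdr _ i) // coprimeXl // prime_coprime.
clearbody u; exists u, i; split=> // [|j].
  case: orb_move => c /cyclic_block_orbit[k ->]; rewrite orb_k uk_cent.
  by apply: contra => dv_p2i; rewrite dvdn_mulr.
(* [p ^ 2] divides [i * i], so [x], [u], [u ^+ i] form a unipotent block. *)
have uib : (u ^+ i) ^ b = u ^+ i.
  apply/eqP; rewrite ukb -[X in _ == X]mulg1 (inj_eq (mulgI _)) u_eq1.
  exact: dvdn_mul.
have cuui : commute u (u ^+ i) by apply: commuteX.
by rewrite (conjg_expg_unipotent j cuui xb ub uib) -expgM -mulgA -expgD.
Qed.

(** [p] divides both [i] and, being odd, ['C(p, 2)]. So [b ^+ p] sends [x] to [x * u ^+ p], where
    [u] has order [p ^ 2]. *)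
Lemma cyclic_block_odd : odd p -> x ^ (b ^+ p) != x /\ (x ^+ p) ^ (b ^+ p) = x ^+ p.
Proof.
move=> odd_p; have [u [i [oru cxu dv_i _ xj]]] := cyclic_block_conj.
have dv_C : p %| 'C(p, 2) by rewrite prime_dvd_bin // odd_prime_gt2.
have dv_e : p ^ 2 %| i * 'C(p, 2) by apply: dvdn_mul.
have xp : x ^ (b ^+ p) = x * u ^+ p.
  rewrite xj expgD; case/dvdnP: dv_e => k ->.
  by rewrite mulnC (expgM u (p ^ 2)) -oru expg_order expg1n mulg1.
split.
  rewrite xp -[X in _ != X]mulg1 (inj_eq (mulgI _)) -order_dvdn oru.
  by rewrite -[X in _ %| X]expn1 dvdn_Pexp2l // prime_gt1.
rewrite conjXg xp expgMn; last exact: commuteX.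
by rewrite -expgM mulnn -oru expg_order mulg1.
Qed.

(** Here [i = 2 * t] with [t] odd. For odd [j] the exponent of [u] is odd, hence prime to the order
    4 of [u]; for even [j] the linear and quadratic terms add up to a multiple of 4. *)
Lemma cyclic_block_even : p = 2 -> forall j,
  x ^ (b ^+ j) = x \/ forall m, (x ^+ m) ^ (b ^+ j) = x ^+ m -> x ^+ m \in 'C[b].
Proof.
move=> p2 j; have [u [i [oru cxu dv_i ndv_i xj]]] := cyclic_block_conj.
have := odd_double_half j; case: (odd j) => /= def_j; [right => m | left].
  rewrite xZ conjXg xj expgMn; last exact: commuteX.
  rewrite -[RHS]mulg1 => /mulgI/eqP; rewrite -expgM -order_dvdn oru.
  rewrite Gauss_dvdr // coprimeXl // prime_coprime // p2.
  move: dv_i; rewrite p2 => dv_i.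
  by rewrite dvdn_addl ?dvdn_mulr // -def_j dvdn2 /= odd_double.
apply/eqP; rewrite xj -[X in _ == X]mulg1 (inj_eq (mulgI _)) -order_dvdn oru.
move: dv_i ndv_i; rewrite p2 => /dvdnP[t ->].
rewrite dvdn_pmul2r // dvdn2 negbK -def_j add0n => odd_t.
case: (j./2) => [|k]; first by rewrite muln0.
have -> : 'C(k.+1.*2, 2) = (k.+1 * k.*2.+1)%N.
  by rewrite bin2 -[_.-1]/(k.*2.+1) -doubleMl doubleK.
have -> : (k.+1.*2 + t * 2 * (k.+1 * k.*2.+1) = 2 * (k.+1 * (t * k.*2.+1).+1))%N by nia.
by rewrite dvdn_pmul2l // dvdn2 oddM !oddS oddM oddS odd_t /= odd_double andbF.
Qed.

End CyclicBlock.

(** * The image of the cyclic normal subgroup *)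

(** Choose [p] so that [B / Z] has [p]-rank at least two, and let [W] consist of the elements of [B]
    with [p]-th power in [Z]. *)
Lemma noncyclic_quotient_exponent (gT : finGroupType) (B Z : {group gT}) :
    abelian B -> Z \subset B -> ~~ cyclic (B / Z) ->
  exists p (W : {group gT}),
    [/\ prime p, Z \subset W, W \subset B & p ^ 2 %| #|W : Z|] /\
    [/\ forall w, w \in W -> w ^+ p \in Z
      & forall b, b \in 'N(B) -> b \in 'N(Z) -> b \in 'N(W)].
Proof.
move=> cBB sZB ncyc.
have nZB : B \subset 'N(Z) by apply: sub_abelian_norm.
have cBZ : abelian (B / Z) by apply: quotient_abelian.
have [p pr_p rp] := rank_witness (B / Z).
have r_gt1 : 1 < 'r_p(B / Z) by rewrite -rp ltnNge -abelian_rank1_cyclic.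
have [E] := p_rank_witness p (B / Z); case/pnElemP=> sEB abelE dimE.
have gW : group_set [set w in B | w ^+ p \in Z].
  apply/group_setP; split=> [|u w]; first by rewrite inE !group1 expg1n group1.
  rewrite !inE => /andP[Bu Zu] /andP[Bw Zw]; rewrite groupM //=.
  by rewrite expgMn ?groupM //; apply: (centsP cBB).
exists p, (group gW); split; split=> //=.
- by apply/subsetP=> z Zz; rewrite inE (subsetP sZB) ?groupX.
- by apply/subsetP=> w; rewrite inE => /andP[].
- have sZW : Z \subset group gW.
    by apply/subsetP=> z Zz; rewrite inE (subsetP sZB) ?groupX.
  have sWB : group gW \subset B by apply/subsetP=> w; rewrite inE => /andP[].
  rewrite -(card_quotient (subset_trans sWB nZB)).
  apply: (@dvdn_trans #|E|).
    by rewrite (card_pgroup (abelem_pgroup abelE)) dimE dvdn_exp2l.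
  apply: cardSg; apply/subsetP=> e Ee.
  have /morphimP[w Nw Bw def_e] := subsetP sEB e Ee.
  rewrite def_e; apply: mem_quotient; rewrite inE Bw /=.
  apply: coset_idr; first exact: groupX.
  rewrite morphX //= -def_e.
  by case/and3P: abelE => _ _ /exponentP; apply.
- by move=> w; rewrite inE => /andP[].
move=> b nBb nZb; rewrite inE; apply/subsetP=> _ /imsetP[w Ww ->].
by move: Ww; rewrite !inE => /andP[Bw Zw]; rewrite memJ_norm // Bw -conjXg memJ_norm.
Qed.

(** A subrack bijection need not respect powers, but it respects centralisers. In [d = z * b ^+ j]
    the factor [z] commutes with [b], hence is central. *)
Lemma cent1_modulo_center (gT : finGroupType) (G B : {group gT}) b d :
    G :=: B * <[b]> -> 'C_B[b] \subset 'Z(G) -> d \in 'C_G[b] ->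
  exists j, forall y, y \in G -> (y \in 'C[d]) = (y \in 'C[b ^+ j]).
Proof.
move=> defG sCZ /setIP[]; rewrite {1}defG => /mulsgP[z _ Bz /cycleP[j ->] ->] cbd.
exists j => y Gy; have Zz : z \in 'Z(G).
  have cbj : b ^+ j \in 'C[b] by rewrite groupX ?cent1id.
  by apply: (subsetP sCZ); rewrite inE Bz /= -(groupMr _ cbj).
have cyz : z \in 'C[y].
  by case/centerP: Zz => _ /(_ y Gy)/cent1P; rewrite cent1C.
by rewrite !(cent1C y) groupMl // cent1C.
Qed.

(** * Transfer of the structure of ['C_G[a]] to [H] *)

Section Transfer.

Variables (gT hT : finGroupType) (G : {group gT}) (H : {group hT}).
Variables (a b : gT) (f : gT -> hT).
Hypotheses (nsaG : <[a]> <| G) (Gb : b \in G) (defG : G :=: <[a]> * <[b]>).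
Hypothesis fP : subrack_bij G H f.

Local Notation A := 'C_G[a].
Local Notation Z := 'Z(G).
Local Notation B := 'C_H[f a].
Local Notation ZH := 'Z(H).

Hypothesis A'b : b \notin A.

Let Ga : a \in G. Proof. by rewrite -cycle_subG normal_sub. Qed.
Let fG x : x \in G -> f x \in H. Proof. exact: (subrack_bij_mem fP). Qed.
Let sAG : A \subset G. Proof. exact: subsetIl. Qed.
Let AG x : x \in A -> x \in G. Proof. exact: subsetP. Qed.
Let sZA : Z \subset A.
Proof.
by rewrite subsetI subsetIl (subset_trans (subsetIr _ _)) // -cent_set1 centS ?sub1set.
Qed.
Let fA : f @: A = B. Proof. exact: (subrack_bij_subcent1 fP). Qed.
Let fZ : f @: Z = ZH. Proof. exact: (subrack_bij_center fP). Qed.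
Let mem_f (S : {set gT}) x : S \subset G -> x \in G -> (f x \in f @: S) = (x \in S).
Proof. exact: (subrack_bij_memE fP). Qed.
Let mem_fA x : x \in G -> (f x \in B) = (x \in A).
Proof. by move=> Gx; rewrite -fA mem_f. Qed.
Let mem_fZ x : x \in G -> (f x \in ZH) = (x \in Z).
Proof. by move=> Gx; rewrite -fZ mem_f // center_sub. Qed.
Let pre_f y : y \in H -> exists2 x, x \in G & y = f x.
Proof. exact: (subrack_bij_surj fP). Qed.
Let cardZ : #|ZH| = #|Z|.
Proof. by rewrite -fZ (card_subrack_bij fP) ?center_sub. Qed.
Let cardB : #|B| = #|A|. Proof. by rewrite -fA (card_subrack_bij fP). Qed.

Lemma image_abelian : abelian B.
Proof.
apply/centsP=> _ /[!(esym fA)] /imsetP[x Ax ->] _ /imsetP[y Ay ->].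
apply/cent1P; rewrite (subrack_bij_cent1 fP) ?AG //; apply/cent1P.
exact: (centsP (metacyclic_cent1_abelian nsaG Gb defG)).
Qed.

Lemma image_normal : B <| H.
Proof.
rewrite /normal subsetIl -fA (subrack_bij_norm fP) // normal_norm //.
exact: metacyclic_cent1_normal.
Qed.

Lemma image_center : 'C_B[f b] = ZH.
Proof.
apply/setP=> y; apply/setIP/idP => [[By] | Zy]; last first.
  split; last by apply/cent1P; case/centerP: Zy => _; apply; apply: fG.
  rewrite inE (subsetP (center_sub _) y Zy) /=.
  by apply/cent1P; case/centerP: Zy => _; apply; apply: fG.
move: By; rewrite -fA => /imsetP[x Ax ->].
have Gx := AG Ax; rewrite (subrack_bij_cent1 fP) // => cbx.
rewrite mem_fZ //.
by rewrite -(metacyclic_cent1_center nsaG Gb defG) inE Ax.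
Qed.

Let nBfb : f b \in 'N(B).
Proof. by rewrite (subsetP (normal_norm image_normal)) ?fG. Qed.

Let sZHB : ZH \subset B. Proof. by rewrite -fZ -fA imsetS. Qed.

(** A Frattini argument: an [H]-conjugate of [f a] lies in [B] and in [subrack2 (f a) (f b)]. As
    [f b] is outside the normal subgroup [B], it is a conjugate of [f a] under [K]. Hence
    [H = B * K]. *)
Lemma image_gen : H :=: B * <[f b]>.
Proof.
set K := <<[set f a; f b]>>.
have Bfa : f a \in B by rewrite mem_fA // inE Ga cent1id.
have sKB : K \subset B * <[f b]>.
  rewrite -norm_joinEr ?cycle_subG // gen_subG subUset !sub1set.
  by rewrite !mem_gen // inE ?Bfa ?cycle_id ?orbT.
have fa_class : f a ^: H \subset f a ^: K.
  have sCG : a ^: G \subset G by rewrite class_subG.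
  have fC : f a ^: H \subset f @: (a ^: G).
    rewrite class_sub_norm ?imset_f ?class_refl //.
    by rewrite (subrack_bij_norm fP) ?class_norm.
  have sCR : f @: (a ^: G) \subset subrack2 (f a) (f b).
    rewrite -(subrack_bij_subrack2 fP) // imsetS // /subrack2.
    by rewrite (metacyclic_gen2 nsaG Gb defG) subsetUl.
  apply/subsetP=> y Cy; have := subsetP sCR y (subsetP fC y Cy).
  case/setUP=> // /imsetP[k Kk def_y].
  have nBH := subsetP (normal_norm image_normal).
  have By : y \in B.
    by case/imsetP: Cy => h Hh ->; rewrite memJ_norm // nBH.
  have Hk : k \in H.
    by move: Kk; apply: subsetP; rewrite gen_subG subUset !sub1set !fG.
  by move: By; rewrite def_y memJ_norm ?nBH // mem_fA // (negPf A'b).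
apply/eqP; rewrite eqEsubset mul_subG ?cycle_subG ?subsetIl ?fG // andbT.
apply/subsetP=> h Hh; have := subsetP fa_class (f a ^ h) (imset_f _ Hh).
case/imsetP=> k Kk eq_hk; rewrite -(mulgKV k h).
have Hk : k \in H.
  by move: Kk; apply: subsetP; rewrite gen_subG subUset !sub1set !fG.
have BhK : h * k^-1 \in B.
  rewrite inE groupM ?groupV //=; apply/cent1P/commute_sym/commgP/conjg_fixP.
  by rewrite conjgM eq_hk conjgK.
have /mulsgP[u v Bu bv def_k] := subsetP sKB k Kk.
by rewrite {2}def_k mulgA mem_mulg // groupM.
Qed.


Lemma card_image_orbit g x : g \in G -> g \notin A -> x \in A ->
  #|f g ^: <<[set f g; f x]>>| = #|g ^: <<[set g; x]>>|.
Proof.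
move=> Gg A'g Ax; rewrite -(subrack_bij_orbit fP (metacyclic_cent1_normal nsaG)) //.
by rewrite (card_subrack_bij fP) // class_subG // gen_subG subUset !sub1set Gg AG.
Qed.

Lemma image_hull x : x \in A ->
  exists2 L : {group hT}, hull B (f b) (f x) L & #|L : ZH| = #[coset Z x].
Proof.
move=> Ax; have Bfx : f x \in B by rewrite mem_fA ?AG.
have [L hL oL] := orbit_hull image_abelian nBfb Bfx; exists L => //.
by rewrite -image_center -oL card_image_orbit // (metacyclic_orbit nsaG Gb defG).
Qed.

(** The hull of any [f x] in [L] stays inside [L], so the order of [x] modulo [Z] divides [m]. This
    gives one inclusion, and the cardinalities agree. *)
Lemma image_root m : m %| #|A : Z| ->
  exists2 L : {group hT}, hull B (f b) (f (center_root G a m)) L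
    & f @: [set x in A | x ^+ m \in Z] = L /\ #|L : ZH| = m.
Proof.
move=> dvm; have Ax := center_root_in nsaG m.
have [L hL oL] := image_hull Ax; exists L => //.
rewrite (order_center_root nsaG Gb defG) // in oL; split=> //.
case: hL => sZL sLB Lx nLb minL; rewrite image_center in sZL.
have sXA : [set x in A | x ^+ m \in Z] \subset A.
  by apply/subsetP=> x /setIdP[].
apply/esym/eqP; rewrite eqEcard (card_subrack_bij fP) ?(subset_trans sXA) //.
rewrite (card_center_root nsaG Gb defG) // -oL -cardZ Lagrange // leqnn andbT.
apply/subsetP=> y Ly; have := subsetP sLB y Ly; rewrite -{1}fA.
case/imsetP=> x Ax' def_y; rewrite def_y imset_f //; apply/setIdP; split=> //.
have [L' [sZL' _ _ _ minL'] oL'] := image_hull Ax'.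
rewrite -(order_coset_center _ (AG Ax')) -oL'.
rewrite image_center in sZL'.
have sL'L : L' \subset L by rewrite minL' ?image_center // -def_y.
by rewrite -(Lagrange_index sL'L sZL') dvdn_mull.
Qed.

(* [Y / ZH] is elementary abelian, while it corresponds to the subgroup of order
   [p ^ 2] of the cyclic group [A / Z]. *)
Lemma noncyclic_block : ~~ cyclic (B / ZH) ->
  exists p (Y Y1 : {group hT}),
    [/\ prime p, p ^ 2 %| #|A : Z|,
        f @: [set x in A | x ^+ (p ^ 2) \in Z] = Y,
        f @: [set x in A | x ^+ p \in Z] = Y1
      & forall y, y \in Y -> y ^+ p \in ZH] /\
    [/\ [/\ Y \subset B, #|Y : ZH| = (p ^ 2)%N & f b \in 'N(Y)],
        [/\ ZH \subset Y1, Y1 \subset Y, #|Y1 : ZH| = p & f b \in 'N(Y1)]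
      & forall (L : {group hT}) y, ZH \subset L -> L \subset Y ->
          f b \in 'N(L) -> y \in L -> y \notin Y1 -> Y \subset L].
Proof.
move=> ncyc; have [p [W [[pr_p sZW sWB dvW] [expW nW]]]] :=
  noncyclic_quotient_exponent image_abelian sZHB ncyc.
have nZfb : f b \in 'N(ZH) by rewrite (subsetP (gFnorm _ _)) ?fG.
have nWb := nW _ nBfb nZfb.
have dvWn : #|W : ZH| %| #|A : Z|.
  have -> : #|A : Z| = #|B : ZH| by rewrite -!divgS // cardB cardZ.
  by rewrite -(Lagrange_index sWB sZW) dvdn_mull.
have dvp2 := dvdn_trans dvW dvWn.
have dvp : p %| #|A : Z| by rewrite (dvdn_trans _ dvp2) // dvdn_exp.
have [Y [sZY sYB Yx nYb minY] [defY oY]] := image_root dvp2.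
have [Y1 [sZY1 sY1B Y1x nY1b minY1] [defY1 oY1]] := image_root dvp.
rewrite image_center in sZY sZY1 minY minY1.
have expS m n : m %| n -> [set x in A | x ^+ m \in Z] \subset [set x in A | x ^+ n \in Z].
  move=> /dvdnP[k ->]; apply/subsetP=> x /setIdP[Ax Zxm]; apply/setIdP; split=> //.
  by rewrite mulnC expgM groupX.
exists p, Y, Y1; split; split=> //.
(* The counting of [image_root] also applies to [W]; as [p ^ 2] divides its index, [Y] lies in
   [W]. *)
- have defW : W :=: f @: [set x in A | x ^+ #|W : ZH| \in Z].
    apply/eqP; rewrite eqEcard; apply/andP; split; last first.
      rewrite (card_subrack_bij fP); last first.
        by apply/subsetP=> x /setIdP[/AG].
      by rewrite (card_center_root nsaG Gb defG) // -cardZ Lagrange.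
    apply/subsetP=> w Ww; have: w \in f @: A by rewrite fA (subsetP sWB).
    case/imsetP=> x Ax def_w; rewrite def_w imset_f //; apply/setIdP; split=> //.
    have [L [sZL _ _ _ minL] oL] := image_hull Ax.
    rewrite -(order_coset_center _ (AG Ax)) -oL.
    rewrite image_center in sZL.
    have sLW : L \subset W by rewrite minL ?image_center // -def_w.
    by rewrite -(Lagrange_index sLW sZL) dvdn_mull.
  move=> y Yy; apply: expW; rewrite defW.
  by apply: (subsetP (imsetS f (expS _ _ dvW))); rewrite defY.
- by split=> //; rewrite -defY1 -defY imsetS // expS // dvdn_exp.
move=> L y sZL sLY nLb Ly Y1'y.
have /imsetP[x] : y \in f @: [set x in A | x ^+ (p ^ 2) \in Z].
  by rewrite defY (subsetP sLY).
case/setIdP=> Ax Zx def_y.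
have [L' [sZL' _ L'y nL'b minL'] oL'] := image_hull Ax.
have sL'L : L' \subset L.
  by rewrite minL' ?image_center ?(subset_trans sLY) // -def_y.
suffices sYL' : Y \subset L' by apply: subset_trans sL'L.
rewrite image_center in sZL'.
have sL'Y : L' \subset Y by rewrite minL' ?image_center // -def_y (subsetP sLY).
(* As [y] is outside [Y1], the order of [x] modulo [Z] divides [p ^ 2] but not [p]. *)
suffices oL'2 : #|L' : ZH| = (p ^ 2)%N.
  rewrite -indexg_eq1 -(eqn_pmul2r (indexg_gt0 L' ZH)).
  by rewrite (Lagrange_index sL'Y sZL') oL'2 oY mul1n.
have Zx' := Zx; rewrite -(order_coset_center _ (AG Ax)) -oL' in Zx'.
have: ~~ (#|L' : ZH| %| p).
  rewrite oL' (order_coset_center _ (AG Ax)); apply: contra Y1'y => Zxp.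
  by rewrite def_y -defY1 imset_f //; apply/setIdP.
case/(dvdn_pfactor _ _ pr_p): Zx' => k; case: k => [|[|[|]]] // _ ->.
  by rewrite dvd1n.
by rewrite expn1 dvdnn.
Qed.

Let mem_cent t g : t \in G -> g \in G -> (f t \in 'C[f g]) = (t \in 'C[g]).
Proof. by move=> Gt Gg; rewrite (subrack_bij_cent1 fP). Qed.

Let fix_cent (rT : finGroupType) (u v : rT) : (u \in 'C[v]) = (u ^ v == u).
Proof. by apply/cent1P/eqP => [/commgP/conjg_fixP | /conjg_fixP/commgP]. Qed.

Lemma image_quotient_cyclic : cyclic (B / ZH).
Proof.
apply: contraT => /noncyclic_block[p [Y [Y1 [[pr_p dvp2 defY defY1 expY]]]]].
case=> [[sYB oY nYb] [sZY1 sY1Y oY1 nY1b] genY].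
have p_gt1 := prime_gt1 pr_p.
have p2_ndv : ~~ (p ^ 2 %| p).
  by rewrite -[X in _ %| X]expn1 dvdn_Pexp2l.
have sZY := subset_trans sZY1 sY1Y.
have cYY : abelian Y := abelianS sYB image_abelian.
have defZ : 'C_Y[f b] = ZH.
  apply/eqP; rewrite eqEsubset; apply/andP; split.
    by rewrite -[in X in _ \subset X]image_center setSI.
  by rewrite subsetI sZY /= -image_center subsetIr.
pose x := center_root G a (p ^ 2).
have Ax : x \in A := center_root_in nsaG _; have Gx := AG Ax.
have ox m : (x ^+ m \in Z) = (p ^ 2 %| m).
  by rewrite -(order_coset_center _ Gx) (order_center_root nsaG Gb defG).
have sXG : [set t in A | t ^+ (p ^ 2) \in Z] \subset G.
  by apply/subsetP=> t /setIdP[/AG].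
have defX := center_root_gen nsaG Gb defG dvp2; rewrite -/x in defX.
have memY t : t \in G -> (f t \in Y) = (t \in <[x]> <*> Z).
  by move=> Gt; rewrite -defX -mem_f // defY.
have Yx m : f (x ^+ m) \in Y.
  by rewrite (memY _ (groupX m Gx)) (subsetP (joing_subl _ _)) ?mem_cycle.
have Yfx : f x \in Y := Yx 1%N.
have Y1'fx : f x \notin Y1.
  rewrite -defY1 mem_f //; last by apply/subsetP=> t /setIdP[/AG].
  by apply/setIdP=> -[_]; rewrite ox (negPf p2_ndv).
have [[Yd CYd] | unip] := block_cases pr_p cYY sZY1 sY1Y nYb nY1b defZ oY oY1 expY genY.
  (* Scalar case: compare the orbit of [d] under [<<[set d; f x]>>] with that of its preimage [g]
     under [<<[set g; x]>>]. *)
  set d := f b ^+ p in Yd CYd.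
  have [g Gg def_d] : exists2 g, g \in G & d = f g by apply/pre_f/groupX/fG.
  have cYd t : t \in G -> t \in <[x]> <*> Z -> t \in 'C[g] -> t \in Z.
    move=> Gt Xt cgt; rewrite -mem_fZ // (subsetP CYd) // inE memY // Xt def_d.
    by rewrite mem_cent.
  have A'g : g \notin A.
    apply/negP=> Ag; have := ox 1%N; rewrite expg1 cYd //.
    - by rewrite dvdn1 -[1%N](expn0 p) eqn_exp2l.
    - by rewrite (subsetP (joing_subl _ _)) ?cycle_id.
    apply/cent1P.
    exact: (centsP (metacyclic_cent1_abelian nsaG Gb defG)).
  have cAA := metacyclic_cent1_abelian nsaG Gb defG.
  have nAg : g \in 'N(A) by rewrite (subsetP (normal_norm (metacyclic_cent1_normal nsaG))).
  have nBd : d \in 'N(B) by rewrite groupX.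
  have Bfx : f x \in B by rewrite mem_fA.
  have [L [sCL _ Lx _ _] oL] := orbit_hull cAA nAg Ax.
  have [L' [sCL' _ _ _ minL'] oL'] := orbit_hull image_abelian nBd Bfx.
  (* [<[f x]> <*> 'C_B[d]] is [d]-stable, so it contains the hull of [f x]. *)
  have le_p : #|L' : 'C_B[d]| <= p.
    have sZC : ZH \subset 'C_B[d].
      rewrite subsetI sZHB; apply/subsetP=> t /centerP[_ cHt].
      by apply/cent1P/cHt; rewrite groupX ?fG.
    have nCB : 'C_B[d] \subset B by apply: subsetIl.
    have nCx : f x \in 'N('C_B[d]).
      by apply: (subsetP (sub_abelian_norm image_abelian nCB)).
    have sL'K : L' \subset <[f x]> <*> 'C_B[d].
      apply: minL'; first exact: joing_subr.
      - by rewrite join_subG cycle_subG Bfx.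
      - by rewrite (subsetP (joing_subl _ _)) ?cycle_id.
      rewrite inE conjYg join_subG -cycleJ cycle_subG /=.
      rewrite (subsetP (genS (setUS <[f x]> sZC))) ?Yd //=.
      have/normP-> : d \in 'N('C_B[d]); last exact: joing_subr.
      by rewrite -sub1set normsI ?sub1set // (subsetP (normG _)) ?cent1id.
    have := index_cycle_joing nCx (subsetP sZC _ (expY _ Yfx)).
    move/(dvdn_leq (prime_gt0 pr_p)); apply: leq_trans.
    by rewrite dvdn_leq // -(Lagrange_index sL'K sCL') dvdn_mull.
  (* The hull contains [<[x]> <*> Z], which meets ['C_A[g]] only in [Z]. *)
  have: p ^ 2 <= #|L : 'C_A[g]|.
    have sXL : <[x]> <*> Z \subset L.
      rewrite join_subG cycle_subG Lx (subset_trans _ sCL) // subsetI sZA.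
      by apply/subsetP=> t /centerP[_ cGt]; apply/cent1P/cGt.
    have <- : #|<[x]> <*> Z : 'C_A[g]| = (p ^ 2)%N.
      rewrite -indexgI -[RHS](order_center_root nsaG Gb defG dvp2) -card_cycle_center //.
      congr #|_ : _|; apply/setP=> t; apply/setIP/idP => [[Xt /setIP[At cgt]] | Zt].
        by rewrite cYd ?AG.
      split; first by rewrite (subsetP (joing_subr _ _)).
      by rewrite inE (subsetP sZA) //=; case/centerP: Zt => _ cGt; apply/cent1P/cGt.
    by rewrite subset_leq_card // imsetS.
  rewrite -oL -card_image_orbit // -def_d oL' => /leq_trans/(_ le_p).
  by rewrite leqNgt -{1}(expn1 p) ltn_exp2l.
have [w [z [[Y1w Z'w Zz nz1] [xb wb wp zp]]]] := unip (f x) Yfx Y1'fx.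
have Yw := subsetP sY1Y w Y1w.
have swap (u v t : hT) : u ^ v = u * t -> v ^ u = v * t^-1.
  move=> uv; rewrite -(mulKg u t) -uv !conjgE !invMg !invgK !mulgA.
  by rewrite mulgV mul1g.
have sK y : y \in <<[set f b; f x]>> -> exists2 c,
    c \in b ^: <<[set b; x]>> & f b ^ y = f c.
  move=> Ky; have : f b ^ y \in f @: (b ^: <<[set b; x]>>).
    rewrite (subrack_bij_orbit fP (metacyclic_cent1_normal nsaG)) //.
    exact: imset_f.
  by case/imsetP=> c; exists c.
have sOG c : c \in b ^: <<[set b; x]>> -> c \in G.
  by apply: subsetP; rewrite class_subG // gen_subG subUset !sub1set Gb.
have Kb : f b \in <<[set f b; f x]>> by rewrite mem_gen ?set21.
have Kx : f x \in <<[set f b; f x]>> by rewrite mem_gen ?set22.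
have Kw : w \in <<[set f b; f x]>>.
  by rewrite -(mulKg (f x) w) -xb groupM ?groupV ?groupJ.
have /setIP[_ cbz] : z \in 'C_Y[f b] by rewrite defZ.
(* The witness comes from [f b ^ w = f b * z^-1], where [z] is central and nontrivial. *)
have orb_fix : exists2 c, c \in b ^: <<[set b; x]>> & (c != b) && (c \in 'C[b]).
  have [c Oc fc] := sK w Kw; exists c => //; have Gc := sOG c Oc.
  rewrite -(mem_cent Gc Gb) -fc (swap _ _ _ wb) groupM ?cent1id ?groupV // andbT.
  apply: contraNneq nz1 => eq_cb; move: fc; rewrite eq_cb (swap _ _ _ wb).
  by rewrite -[RHS]mulg1 => /mulgI/(canRL invgK); rewrite invg1 => ->.
(* The witness comes from [f b ^ f x = f b * w^-1], where [f b] does not centralise [w]. *)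
have orb_move : exists2 c, c \in b ^: <<[set b; x]>> & c \notin 'C[b].
  have [c Oc fc] := sK (f x) Kx; exists c => //; have Gc := sOG c Oc.
  rewrite -(mem_cent Gc Gb) -fc (swap _ _ _ xb) groupMl ?cent1id // groupV.
  apply: contra Z'w => cbw; have: w \in 'C_Y[f b] by rewrite inE Yw.
  by rewrite defZ.
have nxb : b \in 'N(<[x]>).
  have chx : <[x]> \char <[a]>.
    by rewrite sub_cyclic_char ?cycle_cyclic // cycle_subG mem_cycle.
  by rewrite (subsetP (normal_norm (char_normal_trans chx nsaG))).
have xZ m : (x ^+ m \in 'C[b]) = (p ^ 2 %| m).
  rewrite -ox -(metacyclic_cent1_center nsaG Gb defG) [RHS]inE.
  by rewrite (groupX m Ax).
have [p2 | odd_p] := even_prime pr_p; last first.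
  (* For odd [p], [b ^+ p] moves [x] but fixes [x ^+ p]. Its image centralises the same elements as
     some [f b ^+ j], and [block_odd] excludes this behaviour. *)
  have [xbp xpbp] := cyclic_block_odd pr_p nxb xZ orb_fix orb_move odd_p.
  have Hd : f (b ^+ p) \in 'C_H[f b].
    by rewrite inE fG ?groupX // mem_cent ?groupX // cent1id.
  have sCB : 'C_B[f b] \subset ZH by rewrite image_center.
  have [j cdj] := cent1_modulo_center image_gen sCB Hd.
  have [fxj | sCZ] := block_odd pr_p cYY sZY1 sY1Y nYb defZ oY1 genY j
    odd_p Y1w Z'w Zz nz1 xb wb wp zp.
    case/negP: xbp; rewrite -fix_cent -mem_cent ?groupX // cdj ?fG //.
    by rewrite fix_cent fxj.
  case/negP: p2_ndv; rewrite -ox -(mem_fZ (groupX p Gx)); apply: (subsetP sCZ).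
  apply/setIP; split; first exact: Yx.
  rewrite -(cdj _ (fG (groupX p Gx))) (mem_cent (groupX p Gx) (groupX p Gb)).
  by rewrite fix_cent xpbp.
(* For [p = 2] the roles are exchanged: [f b ^+ p] fixes [w] but moves [f x], while its preimage [g]
   centralises the same elements as some [b ^+ j], against [cyclic_block_even]. *)
have [g Gg def_d] : exists2 g, g \in G & f b ^+ p = f g by apply/pre_f/groupX/fG.
have Cg : g \in 'C_G[b].
  by rewrite inE Gg -mem_cent // -def_d groupX ?cent1id.
have defGA : G :=: A * <[b]>.
  apply/eqP; rewrite eqEsubset mul_subG ?cycle_subG // andbT {1}defG mulSg //.
  by rewrite cycle_subG inE Ga cent1id.
have sCA : 'C_A[b] \subset Z by rewrite (metacyclic_cent1_center nsaG Gb defG).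
have [j cgj] := cent1_modulo_center defGA sCA Cg.
have [xd wd] := block_conjX cYY sZY1 sY1Y defZ p Yw Zz xb wb.
have [t Gt def_w] : exists2 t, t \in G & w = f t.
  by apply: pre_f; rewrite (subsetP (subset_trans sYB (subsetIl _ _))).
case: (cyclic_block_even pr_p nxb xZ orb_fix orb_move p2 j) => [xj | fixj].
  case/negP: nz1; have: f x \in 'C[f g] by rewrite mem_cent // cgj // fix_cent xj.
  rewrite fix_cent -def_d xd wp mulg1 p2 binn expg1 -[X in _ == X]mulg1.
  by rewrite (inj_eq (mulgI _)).
case/negP: Z'w; rewrite def_w mem_fZ //.
have: t \in <[x]> <*> Z by rewrite -memY // -def_w.
rewrite cent_joinEr; last first.
  by rewrite (subset_trans (subsetIr _ _)) // centS // cycle_subG.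
case/mulsgP=> _ s /cycleP[m ->] Zs def_t.
have: t \in 'C[b ^+ j].
  rewrite -cgj // -mem_cent // -def_w -def_d fix_cent wd p2.
  by rewrite p2 in zp; rewrite zp mulg1.
have cbs : s \in 'C[b ^+ j].
  by case/centerP: (Zs) => _ cGs; apply/cent1P/cGs; rewrite groupX.
rewrite def_t groupMr // fix_cent => /eqP/fixj; rewrite xZ -ox => Zxm.
by rewrite groupM.
Qed.

End Transfer.

Theorem theorem3 (gT hT : finGroupType) (G : {group gT}) (H : {group hT}) :
  metacyclic G ->
  lattice_isomorphic (subrack (group_rack G)) (subrack (group_rack H)) ->
  metacyclic (H / 'Z(H))%g.
Proof.
move=> /metacyclic_cycles[a [b [nsaG Gb defG]]] /lattice_iso_subrack_bij[f fP].
have Ga : a \in G by rewrite -cycle_subG normal_sub.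
(* If [b] commutes with [a], then [G] is abelian and the centre of [H] is the image of [G], that is
   [H]. *)
have [Ab | A'b] := boolP (b \in 'C_G[a]).
  have cGG : abelian G.
    rewrite -(metacyclic_gen2 nsaG Gb defG) abelian_gen.
    have cab : commute a b by case/setIP: Ab => _ /cent1P.
    apply/centsP=> u; rewrite !inE => /orP[] /eqP-> v; rewrite !inE => /orP[] /eqP-> //.
  have -> : 'Z(H) = H.
    by rewrite -(subrack_bij_center fP) (center_idP cGG); case: fP.
  by rewrite trivg_quotient metacyclic1.
have nsBH := image_normal nsaG fP; set B := 'C_H[f a] in nsBH.
have sZB : 'Z(H) \subset B.
  by rewrite -(image_center nsaG Gb defG fP) subsetIl.
have nsZH : 'Z(H) <| H := center_normal H.
apply/metacyclicP; exists ('C_H[f a] / 'Z(H))%G; split.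
- exact: (image_quotient_cyclic nsaG Gb defG fP A'b).
- exact: quotient_normal.
rewrite (isog_cyclic (third_isog sZB nsZH nsBH)) /=.
have -> : H / B = <[f b]> / B.
  by rewrite {1}(image_gen nsaG Gb defG fP A'b) quotientMidl.
by rewrite quotient_cyclic ?cycle_cyclic.
Qed.
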